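(* Fix a prime power $q$. For all modified types $\boldsymbol\mu,\boldsymbol\nu,\boldsymbol\lambda$ there exist polynomials $r_{\boldsymbol\mu,\boldsymbol\nu}^{\boldsymbol\lambda}\in\mathcal{R}_q$, with only finitely many $\boldsymbol\lambda$ giving a nonzero $r_{\boldsymbol\mu,\boldsymbol\nu}^{\boldsymbol\lambda}$ for fixed $\boldsymbol\mu,\boldsymbol\nu$, such that for every integer $m\ge 0$, in $Z(\mathbb{Z}GL_m(\mathbb{F}_q))$, \[ X_{\boldsymbol\mu,m}X_{\boldsymbol\nu,m}=\sum_{\boldsymbol\lambda} r_{\boldsymbol\mu,\boldsymbol\nu}^{\boldsymbol\lambda}([m]_q)\,X_{\boldsymbol\lambda,m}, \] the sum ranging over all modified types $\boldsymbol\lambda$.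
   Context: $q$ is a fixed prime power. For $n\in\mathbb{Z}$ put $[n]_q=(q^n-1)/(q-1)\in\mathbb{Z}[q^{-1}]$ and $[k]_q!=[k]_q[k-1]_q\cdots[1]_q$, $[0]_q!=1$. For $k\ge 0$ let $\binom{x}{k}_q=\frac{x(x-[1]_q)\cdots(x-[k-1]_q)}{q^{k(k-1)/2}[k]_q!}\in\mathbb{Q}[x]$ (equal to $1$ for $k=0$). $\mathcal{R}_q$ denotes the set of $\mathbb{Z}[q,q^{-1}]$-linear combinations of the polynomials $\binom{x}{k}_q$, $k\ge0$ (the ring of quantum integer-valued polynomials specialised at the prime power $q$). Let $\Phi_q$ be the set of monic irreducible polynomials over $\mathbb{F}_q$ other than $t$. The type of $g\in GL_n(\mathbb{F}_q)$ is the function $\boldsymbol\mu$ from $\Phi_q$ to partitions such that the number of parts of $\boldsymbol\mu(r)$ equal to $i$ is the multiplicity of $r(t)^i$ as an elementary divisor of the $\mathbb{F}_q[t]$-module $\mathbb{F}_q^n$ with $t$ acting by $g$; two elements are conjugate iff they have the same type. The modified type of $g$ is obtained from its type by replacing the partition $\boldsymbol\mu(t-1)$ with the partition obtained by subtracting $1$ from each of its parts (and discarding zero parts), leaving $\boldsymbol\mu(r)$ unchanged for $r\ne t-1$. A modified type means any function $\Phi_q\to\{\text{partitions}\}$ with finitely many nonempty values. $X_{\boldsymbol\nu,n}\in Z(\mathbb{Z}GL_n(\mathbb{F}_q))$ is the sum of all elements of $GL_n(\mathbb{F}_q)$ of modified type $\boldsymbol\nu$ (zero if there are none). *)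

(* Defs.v *)
From HB Require Import structures.
From mathcomp Require Import all_boot all_algebra.
From mathcomp Require Import finmap.
From mathcomp Require Import boolp.
Set Implicit Arguments. Unset Strict Implicit. Unset Printing Implicit Defensive.
Import GRing.Theory Num.Theory.
Local Open Scope ring_scope.
Local Open Scope fmap_scope.

Definition qint (q : nat) (n : nat) : rat := ((q%:R : rat) ^+ n - 1) / (q%:R - 1).

Definition qfact (q : nat) (k : nat) : rat := \prod_(1 <= i < k.+1) qint q i.

Definition qbinom (q : nat) (k : nat) : {poly rat} :=
  (\prod_(i < k) ('X - (qint q i)%:P)) *
  (((q%:R : rat) ^+ ((k * (k - 1)) %/ 2) * qfact q k)^-1)%:P.

Definition in_Zqqinv (q : nat) (c : rat) : Prop :=
  exists (s : seq int) (e : nat),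
    c = (\sum_(i < size s) (s`_i)%:~R * (q%:R : rat) ^+ i) / (q%:R : rat) ^+ e.

Definition in_Rq (q : nat) (p : {poly rat}) : Prop :=
  exists (n : nat) (c : nat -> rat),
    (forall k, in_Zqqinv q (c k)) /\ p = \sum_(k < n) c k *: qbinom q k.

(* A (modified) type: a finitely supported function from Phi_q to partitions,
   represented canonically as a finite map whose domain is the support
   (the keys with nonempty partition). *)
Definition modtype (F : finFieldType) := {fmap {poly F} -> seq nat}.

Definition is_partition (s : seq nat) : bool :=
  sorted geq s && all (fun i => 0 < i)%N s.

Definition in_Phi (F : finFieldType) (r : {poly F}) : Prop :=
  [/\ irreducible_poly r, r \is monic & r != 'X].

Definition is_modtype (F : finFieldType) (mu : modtype F) : Prop :=
  forall r : {poly F}, r \in domf mu ->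
    in_Phi r /\ (is_partition (odflt [::] mu.[? r]) /\ odflt [::] mu.[? r] != [::]).

Definition elem_divs (F : finFieldType) (tau : modtype F) : seq {poly F} :=
  flatten [seq [seq r ^+ i | i <- odflt [::] tau.[? r]] | r <- domf tau].

(* evaluation of a polynomial at a square matrix (valid for every size n) *)
Definition peval_mx (F : finFieldType) (n : nat) (g : 'M[F]_n) (p : {poly F}) : 'M[F]_n :=
  \sum_(i < size p) p`_i *: g ^+ i.

(* g has type tau: F^n (t acting by g) decomposes as a direct sum of cyclic
   submodules F[t] v_l with v_l annihilated by the elementary divisor d_l and
   with F-basis {g^j v_l : j < deg d_l}, i.e. F^n ~= (+)_l F[t]/(d_l). *)
Definition has_type (F : finFieldType) (n : nat) (g : 'M[F]_n) (tau : modtype F) : Prop :=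
  is_modtype tau /\
  exists vs : seq 'cV[F]_n,
    let D := elem_divs tau in
    [/\ size vs = size D,
        forall l, (l < size D)%N -> peval_mx g (D`_l) *m vs`_l = 0
      & basis_of fullv
          (flatten [seq [seq g ^+ j *m dv.2 | j <- iota 0 (size dv.1).-1]
                   | dv : {poly F} * 'cV[F]_n <- zip D vs])].

Definition modify (F : finFieldType) (tau : modtype F) : modtype F :=
  let p := [seq i.-1 | i <- odflt [::] tau.[? ('X - 1)] & (1 < i)%N] in
  if p is [::] then tau.[~ ('X - 1)] else tau.[('X - 1) <- p].

Definition has_mtype (F : finFieldType) (n : nat) (g : 'M[F]_n) (mu : modtype F) : Prop :=
  exists tau : modtype F, has_type g tau /\ modify tau = mu.

(* ---------- the group ring Z GL_n(F_q): functions 'M[F]_n -> int supported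
   on the invertible matrices; product = convolution *)
Definition Xcls (F : finFieldType) (mu : modtype F) (n : nat) : 'M[F]_n -> int :=
  fun g => ((g \in unitmx) && `[< has_mtype g mu >])%:R.

Definition gmul (F : finFieldType) (n : nat) (x y : 'M[F]_n -> int) : 'M[F]_n -> int :=
  fun h => \sum_(a : 'M[F]_n) \sum_(b : 'M[F]_n) (a *m b == h)%:R * x a * y b.
Arguments Xcls {F} mu n _.

(* Main.v *)
Require Import Defs.
From HB Require Import structures.
From mathcomp Require Import all_boot all_algebra.
From mathcomp Require Import finmap.
From mathcomp Require Import boolp mxabelem zify ring.
Set Implicit Arguments. Unset Strict Implicit. Unset Printing Implicit Defensive.
Import GRing.Theory Num.Theory.
Local Open Scope ring_scope.

(** Factor [a - 1 = P Q] through its image, with [P] injective and [Q]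
surjective of rank [k]: the modified type of [a] is the ordinary type of the
[k x k] matrix [1 + Q P], which does not involve the size [m]. Fix
[h = 1 + H1 H2] in this way. Then counting the factorisations [h = a b] with
[a], [b] of given modified types amounts, up to the constant factor
[|GL_k| |GL_l|], to counting the tuples [(P, Q, R, S)] with [a = 1 + P Q],
[b = 1 + R S]. All the conditions on such a tuple depend only on the kernel of
[X = (H1 P R)], the cokernel of [Y = (H2; Q; S)] and the product [Y X], a finite
set of data independent of [m]; and for fixed data, choosing the columns of [X]
and the rows of [Y] one at a time shows that the number of tuples is a
polynomial in [q ^ m].

The count is an integer as soon as [m] is large enough. Powers of [q] are
ultimately periodic modulo a common denominator of the coefficients, so the
polynomial takes values in [Z[1/q]] at [[m]_q] for all [m], and Newton
interpolation on the points [[m]_q] puts it in [R_q]. *)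

(** * Interpolation at the quantum integers *)

Section Interpolation.
Variable q : nat.
Hypothesis q_gt1 : (1 < q)%N.
Local Notation Q := (q%:R : rat).

Lemma qrat_neq0 : Q != 0. Proof. by rewrite pnatr_eq0; lia. Qed.
Lemma qrat_neq1 : Q - 1 != 0. Proof. by rewrite subr_eq0 pnatr_eq1; lia. Qed.

(** As [q] is a number, the numerator polynomial is just an integer: membership means that some
    power of [q] clears the denominator. *)
Lemma in_ZqqinvP (c : rat) :
  in_Zqqinv q c <-> exists e (z : int), c * Q ^+ e = z%:~R.
Proof.
split=> [[s [e ->]]|[e [z ce]]].
  exists e, (\sum_(i < size s) s`_i * (q%:Z) ^+ i).
  rewrite divfK ?expf_neq0 ?qrat_neq0 // rmorph_sum /=.
  by apply: eq_bigr => i _; rewrite rmorphM rmorphXn.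
exists [:: z], e; rewrite big_ord1 expr0 mulr1 /= -ce mulfK //.
by rewrite expf_neq0 ?qrat_neq0.
Qed.

Lemma in_Zqqinv_int (z : int) : in_Zqqinv q z%:~R.
Proof. by apply/in_ZqqinvP; exists 0%N, z; rewrite expr0 mulr1. Qed.

Lemma in_ZqqinvD c d : in_Zqqinv q c -> in_Zqqinv q d -> in_Zqqinv q (c + d).
Proof.
move=> /in_ZqqinvP[e [z ce]] /in_ZqqinvP[f [w df]]; apply/in_ZqqinvP.
exists (e + f)%N, (z * q%:Z ^+ f + w * q%:Z ^+ e).
by rewrite rmorphD !rmorphM !rmorphXn /= -ce -df exprD; ring.
Qed.

Lemma in_ZqqinvM c d : in_Zqqinv q c -> in_Zqqinv q d -> in_Zqqinv q (c * d).
Proof.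
move=> /in_ZqqinvP[e [z ce]] /in_ZqqinvP[f [w df]]; apply/in_ZqqinvP.
by exists (e + f)%N, (z * w); rewrite rmorphM /= -ce -df exprD; ring.
Qed.

Lemma in_Zqqinv_sum n (f : 'I_n -> rat) :
  (forall i, in_Zqqinv q (f i)) -> in_Zqqinv q (\sum_i f i).
Proof.
move=> fP; elim/big_ind: _ => //; [exact: (in_Zqqinv_int 0)|exact: in_ZqqinvD].
Qed.

Lemma qintS n : qint q n.+1 = Q * qint q n + 1.
Proof. by rewrite /qint exprS; field; rewrite qrat_neq1. Qed.

Lemma qint0 : qint q 0 = 0. Proof. by rewrite /qint expr0 subrr mul0r. Qed.

Lemma qintE n : Q ^+ n = 1 + (Q - 1) * qint q n.
Proof. by rewrite /qint; field; rewrite qrat_neq1. Qed.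

Lemma qint_inj : injective (qint q).
Proof.
move=> m n /(congr1 (fun x => 1 + (Q - 1) * x)); rewrite -!qintE -!natrX.
by move=> /eqP; rewrite eqr_nat eqn_exp2l // => /eqP.
Qed.

Lemma qintS_neq0 n : qint q n.+1 != 0.
Proof. by apply/eqP; rewrite -qint0 => /qint_inj. Qed.

Let den k : rat := Q ^+ ((k * (k - 1)) %/ 2) * qfact q k.
Let num k n : rat := \prod_(i < k) (qint q n - qint q i).

Lemma denS k : den k.+1 = den k * (Q ^+ k * qint q k.+1).
Proof.
rewrite /den /qfact big_nat_recr //=.
have -> : ((k.+1 * (k.+1 - 1)) %/ 2 = (k * (k - 1)) %/ 2 + k)%N.
  rewrite -[in RHS](mulnK k (isT : 0 < 2)%N) -divnDr ?dvdn_mull //.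
  by congr (_ %/ 2)%N; case: k => // k; rewrite !subn1 /=; nia.
by rewrite exprD; ring.
Qed.

Lemma den_neq0 k : den k != 0.
Proof.
elim: k => [|k IH]; first by rewrite /den /qfact big_geq // mul1r oner_neq0.
rewrite denS mulf_neq0 // mulf_neq0 ?qintS_neq0 //.
by rewrite expf_neq0 ?qrat_neq0.
Qed.

Lemma qbinomE k n : (qbinom q k).[qint q n] = num k n / den k.
Proof.
rewrite /qbinom hornerM hornerC horner_prod; congr (_ * _).
by apply: eq_bigr => i _; rewrite !hornerE.
Qed.

Lemma numSr k n : num k.+1 n = num k n * (qint q n - qint q k).
Proof. by rewrite /num big_ord_recr. Qed.

(** Since [[n+1] - [i+1] = q ([n] - [i])], every factor except the one for [i = 0] releases one
    [q]. *)
Lemma numSS k n : num k.+1 n.+1 = qint q n.+1 * (Q ^+ k * num k n).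
Proof.
rewrite /num big_ord_recl qint0 subr0; congr (_ * _).
elim: k => [|k IH]; first by rewrite !big_ord0 expr0 mulr1.
by rewrite !big_ord_recr /= IH /bump /= !qintS exprS; ring.
Qed.

(** The q-Pascal rule: it carries membership in [Z[1/q]] from one row of the triangle to the
    next. *)
Lemma qbinom_pascal k n : (qbinom q k.+1).[qint q n.+1] =
  Q ^+ k.+1 * (qbinom q k.+1).[qint q n] + (qbinom q k).[qint q n].
Proof.
rewrite !qbinomE numSS numSr denS exprS.
have := den_neq0 k; have := qintS_neq0 k; rewrite !qintS => h1 h2.
have h3 : Q ^+ k != 0 by rewrite expf_neq0 ?qrat_neq0.
by field; rewrite h1 h2 h3.
Qed.

Lemma qbinom_small k n : (n < k)%N -> (qbinom q k).[qint q n] = 0.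
Proof.
move=> ltnk; rewrite qbinomE /num (bigD1 (Ordinal ltnk)) //= subrr.
by rewrite !mul0r.
Qed.

Lemma qbinom0 : qbinom q 0 = 1.
Proof. by rewrite /qbinom /qfact big_ord0 big_geq // mul1r mulr1 invr1. Qed.

Lemma qbinomnn n : (qbinom q n).[qint q n] = 1.
Proof.
elim: n => [|n IH]; first by rewrite qbinom0 hornerC.
by rewrite qbinom_pascal qbinom_small // mulr0 add0r.
Qed.

Lemma in_Zqqinv_qbinom k n : in_Zqqinv q (qbinom q k).[qint q n].
Proof.
elim: n k => [|n IH] [|k].
- by rewrite qbinomnn; exact: (in_Zqqinv_int 1).
- by rewrite qbinom_small //; exact: (in_Zqqinv_int 0).
- by rewrite qbinom0 hornerC; exact: (in_Zqqinv_int 1).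
rewrite qbinom_pascal; apply: in_ZqqinvD => //; apply: in_ZqqinvM => //.
have -> : Q ^+ k.+1 = (q ^ k.+1)%:Z%:~R by rewrite -natrX.
exact: in_Zqqinv_int.
Qed.

Lemma size_qbinom k : (size (qbinom q k) <= k.+1)%N.
Proof.
rewrite /qbinom mulrC mul_polyC (leq_trans (size_scale_leq _ _)) //.
elim: k => [|k IH]; first by rewrite big_ord0 size_poly1.
rewrite big_ord_recr /= (leq_trans (size_polyMleq _ _)) // size_XsubC addn2 /=.
by rewrite ltnS.
Qed.

(** Newton interpolation at [[0], [1], ...]: the matrix of values [(qbinom q k).[qint q n]] is
    unitriangular over [Z[1/q]], so the coefficients come from the values of [p] without
    division. *)
Lemma in_Rq_values (p : {poly rat}) :
  (forall m, in_Zqqinv q p.[qint q m]) -> in_Rq q p.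
Proof.
move=> pZ.
have newton n : exists c : nat -> rat, (forall k, in_Zqqinv q (c k)) /\
    forall m, (m < n)%N -> (p - \sum_(k < n) c k *: qbinom q k).[qint q m] = 0.
  elim: n => [|n [c [cZ cP]]].
    by exists (fun=> 0); split=> // k; exact: (in_Zqqinv_int 0).
  (* The new coefficient is the error at [[n]], because [qbinom q n] is 1 there and 0 at the earlier
     points. *)
  pose d := (p - \sum_(k < n) c k *: qbinom q k).[qint q n].
  exists (fun k => if k == n then d else c k); split.
    move=> k; case: eqP => // _; rewrite /d hornerD hornerN.
    apply: in_ZqqinvD => //; rewrite -mulN1r; apply: in_ZqqinvM.
      exact: (in_Zqqinv_int (-1)).
    rewrite horner_sum; apply: in_Zqqinv_sum => i.
    by rewrite hornerZ; apply: in_ZqqinvM => //; exact: in_Zqqinv_qbinom.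
  move=> m; rewrite ltnS big_ord_recr /= eqxx opprD addrA => le_mn.
  rewrite (eq_bigr (fun k : 'I_n => c k *: qbinom q k)) => [|i _]; last first.
    by rewrite (ltn_eqF (ltn_ord i)).
  rewrite hornerD hornerN hornerZ; case: (ltngtP m n) le_mn => // [ltmn _|-> _].
    by rewrite cP // qbinom_small // mulr0 subrr.
  by rewrite qbinomnn mulr1 subrr.
have [c [cZ cP]] := newton (size p); exists (size p), c; split=> //.
(* The difference has degree below [size p] and vanishes at [size p] distinct points. *)
apply/eqP; rewrite -subr_eq0; apply/negP => /negP nz.
have := @max_poly_roots _ _ [seq qint q m | m <- iota 0 (size p)] nz.
rewrite size_map size_iota map_inj_uniq ?iota_uniq //; last exact: qint_inj.
have -> : all (root (p - \sum_(k < size p) c k *: qbinom q k))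
    [seq qint q m | m <- iota 0 (size p)].
  apply/allP => x /mapP[m]; rewrite mem_iota add0n => /andP[_ ltm] ->.
  by rewrite /root cP.
move=> /(_ isT isT); apply/negP; rewrite -leqNgt.
rewrite (leq_trans (size_polyD _ _)) // geq_max leqnn size_polyN /=.
rewrite (leq_trans (size_sum _ _ _)) //; apply/bigmax_leqP => i _.
rewrite (leq_trans (size_scale_leq _ _)) // (leq_trans (size_qbinom _)) //.
Qed.

(** Pigeonhole on [D.+1] powers. The preperiod [a] accounts for common factors of [q] and [D]. *)
Lemma expn_mod_periodic D : (0 < D)%N ->
  exists a t, (0 < t)%N /\ forall i j, (a <= i)%N -> q ^ (i + t * j) = q ^ i %[mod D].
Proof.
move=> D_gt0; pose f (i : 'I_D.+1) := Ordinal (ltn_pmod (q ^ i) D_gt0).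
have /injectivePn[i [j neq /(congr1 val) /= eqf]] : ~~ injectiveb f.
  by apply/negP => /injectiveP /leq_card; rewrite !card_ord ltnn.
wlog ltij : i j neq eqf / (i < j)%N.
  move=> H; case: (ltngtP i j) => [lt|lt|/val_inj/eqP]; last by rewrite (negPf neq).
    exact: (H i j).
  by apply: (H j i); rewrite // eq_sym.
have per k : (i <= k)%N -> q ^ (k + (j - i)) = q ^ k %[mod D].
  move=> le; have -> : (k + (j - i) = (k - i) + j)%N by lia.
  by rewrite expnD -modnMmr -eqf modnMmr -expnD subnK.
exists i, (j - i)%N; split=> [|k l le]; first by rewrite subn_gt0.
elim: l => [|l IH]; first by rewrite muln0 addn0.
by rewrite mulnSr addnA per //; lia.
Qed.

(* Periodicity of the powers of [q] modulo a common denominator of the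
   coefficients extends integrality up to powers of [q] downwards from [m0]. *)
Lemma in_Zqqinv_extend (p : {poly rat}) m0 :
  (forall m, (m0 <= m)%N -> exists z : int, p.[Q ^+ m] = z%:~R) ->
  forall m, in_Zqqinv q p.[Q ^+ m].
Proof.
move=> pZ m.
have [D [g [D_gt0 gE]]] : exists (D : nat) (g : {poly int}), (0 < D)%N /\
    forall x : int, D%:R * p.[x%:~R] = g.[x]%:~R.
  have [P [a a_neq0 pE]] := rat_poly_scale p.
  (* Taking the square of the scaling factor [a] as denominator avoids tracking its sign. *)
  exists (`|a| * `|a|)%N, (a *: P); split; first by rewrite muln_gt0 absz_gt0 a_neq0.
  move=> x; rewrite pE hornerZ horner_map hornerZ rmorphM /= mulrA.
  have -> : `|a|%:R * `|a|%:R = a%:~R * a%:~R :> rat.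
    by rewrite !natr_absz -!intrM -normrM ger0_norm ?sqr_ge0.
  by rewrite mulfK ?intr_eq0 // rmorphM.
have [a [t [t_gt0 per]]] := expn_mod_periodic D_gt0.
have qZ k : Q ^+ k = (q%:Z ^+ k)%:~R by rewrite rmorphXn.
(* The factor [q ^ a] moves all exponents into the periodic range, where the shift by [t * m0 * i]
   in the [i]-th term is invisible modulo [D]. At [m + t * m0], which is at least [m0], the value is
   known to be an integer. *)
have [w wE] : exists w : int,
    q%:Z ^+ a * (g.[q%:Z ^+ (m + t * m0)] - g.[q%:Z ^+ m]) = w * D%:Z.
  apply/dvdzP; rewrite !horner_coef -sumrB mulr_sumr.
  apply: rpred_sum => i _; rewrite -mulrBr mulrCA; apply: dvdz_mull.
  rewrite mulrBr -!exprM -!exprD -eqz_mod_dvd.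
  rewrite mulnDl addnA -mulnA; apply/eqP.
  have := @per (a + m * i)%N (m0 * i)%N (leq_addr _ _).
  have qN k : (q%:Z ^+ k = (q ^ k)%:Z) by rewrite -!natz natrX.
  by rewrite !qN !modz_nat => ->.
have [z zE] := pZ (m + t * m0)%N (leq_trans (leq_pmull _ t_gt0) (leq_addl _ _)).
apply/in_ZqqinvP; exists a, (q%:Z ^+ a * z - w).
have D_neq0 : D%:R != 0 :> rat by rewrite pnatr_eq0 -lt0n.
apply: (mulfI D_neq0); move: (gE (q%:Z ^+ (m + t * m0))) (gE (q%:Z ^+ m)).
rewrite -!qZ zE => g1 g2; rewrite mulrA g2 rmorphB rmorphM /= -qZ mulrBr.
have /(congr1 (fun x : int => x%:~R : rat)) := wE.
rewrite !rmorphM rmorphB /= -g1 -qZ => e1.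
rewrite [D%:R * w%:~R]mulrC -[w%:~R * _]e1; ring.
Qed.

(** The substitution [1 + (q - 1) X] trades the variable [q ^ m] for [[m]]. *)
Lemma in_Rq_of_int (p : {poly rat}) m0 :
  (forall m, (m0 <= m)%N -> exists z : int, p.[Q ^+ m] = z%:~R) ->
  exists2 r, in_Rq q r & forall m, r.[qint q m] = p.[Q ^+ m].
Proof.
move=> pZ; exists (p \Po (1%:P + (Q - 1) *: 'X)) => [|m]; last first.
  by rewrite horner_comp hornerD hornerZ hornerX hornerC -qintE.
apply: in_Rq_values => m; rewrite horner_comp hornerD hornerZ hornerX hornerC -qintE.
exact: in_Zqqinv_extend pZ m.
Qed.
End Interpolation.

(** * Similarity and companion matrices *)

Lemma mx0_eq (R : Type) (A B : 'M[R]_0) : A = B.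
Proof. by apply/matrixP => -[]. Qed.

Section PolyEval.
Variables (F : finFieldType) (n : nat).
Implicit Types (g : 'M[F]_n) (p : {poly F}).

Lemma peval_mxE n' (g : 'M[F]_n'.+1) p : peval_mx g p = horner_mx g p.
Proof.
rewrite -[p in RHS]coefK poly_def linear_sum; apply: eq_bigr => i _.
by rewrite linearZ rmorphXn /= horner_mx_X.
Qed.

Fact peval_mx_is_linear g : linear (peval_mx g).
Proof.
move=> a p r; case: n g => [|n'] g; first refine (@mx0_eq F _ _).
by rewrite !peval_mxE linearP.
Qed.

Fact peval_mx_is_monoid_morphism g : monoid_morphism (peval_mx g).
Proof.
case: n g => [|n'] g; first by split=> [|p r]; refine (@mx0_eq F _ _).
by split=> [|p r]; rewrite !peval_mxE ?rmorph1 ?rmorphM.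
Qed.

HB.instance Definition _ g :=
  GRing.isLinear.Build F {poly F} 'M[F]_n _ (peval_mx g) (peval_mx_is_linear g).
HB.instance Definition _ g :=
  GRing.isMonoidMorphism.Build {poly F} 'M[F]_n (peval_mx g)
    (peval_mx_is_monoid_morphism g).

Lemma peval_mxX g : peval_mx g 'X = g.
Proof.
case: n g => [|n'] g; first refine (@mx0_eq F _ _).
by rewrite peval_mxE horner_mx_X.
Qed.

Lemma peval_mxC g a : peval_mx g a%:P = a%:M.
Proof.
case: n g => [|n'] g; first refine (@mx0_eq F _ _).
by rewrite peval_mxE horner_mx_C.
Qed.

Lemma peval_mxM g p r : peval_mx g (p * r) = peval_mx g p *m peval_mx g r.
Proof. by rewrite rmorphM. Qed.

Lemma peval_mx_wide g p k : (size p <= k)%N ->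
  peval_mx g p = \sum_(i < k) p`_i *: g ^+ i.
Proof.
move=> lepk; rewrite /peval_mx (big_ord_widen k (fun i => p`_i *: g ^+ i)) //.
rewrite [RHS](bigID (fun i : 'I_k => (i < size p)%N)) /= [X in _ + X]big1 ?addr0 // => i.
by rewrite -leqNgt => lei; rewrite nth_default ?scale0r.
Qed.
End PolyEval.

Lemma peval_mx_intertwine (F : finFieldType) m n (g : 'M[F]_m) (g' : 'M[F]_n)
    (B : 'M_(m, n)) p :
  g *m B = B *m g' -> peval_mx g p *m B = B *m peval_mx g' p.
Proof.
move=> gB; elim/poly_ind: p => [|p c IH]; first by rewrite !linear0 mul0mx.
rewrite !rmorphD /= !peval_mxM !peval_mxX !peval_mxC mulmxDl mulmxDr.
by rewrite -mulmxA gB mulmxA IH mulmxA mul_scalar_mx mul_mx_scalar.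
Qed.

Section Similarity.
Variable F : finFieldType.

(** The two sizes may differ formally: block-diagonal forms have sizes such as [csize D], whose
    equality with [n] is a consequence of similarity. *)
Definition simmx m n (g : 'M[F]_m) (g' : 'M[F]_n) :=
  exists B C, [/\ B *m C = 1%:M, C *m B = 1%:M & g *m B = B *m g'].

Lemma simmx_refl n (g : 'M[F]_n) : simmx g g.
Proof. by exists 1%:M, 1%:M; rewrite !mulmx1 mul1mx. Qed.

Lemma simmx_sym m n (g : 'M[F]_m) (g' : 'M[F]_n) : simmx g g' -> simmx g' g.
Proof.
move=> [B [C [BC CB gB]]]; exists C, B; split=> //.
by rewrite -[g' *m C]mul1mx -CB -mulmxA [B *m _]mulmxA -gB -!mulmxA BC mulmx1.
Qed.

Lemma simmx_trans m n k (g : 'M[F]_m) (g' : 'M[F]_n) (g'' : 'M[F]_k) :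
  simmx g g' -> simmx g' g'' -> simmx g g''.
Proof.
move=> [B [C [BC CB gB]]] [B' [C' [BC' CB' gB']]].
exists (B *m B'), (C' *m C); split.
- by rewrite mulmxA -[B *m B' *m C']mulmxA BC' mulmx1.
- by rewrite mulmxA -[C' *m C *m B]mulmxA CB mulmx1.
by rewrite mulmxA gB -mulmxA gB' mulmxA.
Qed.

Lemma simmx_size m n (g : 'M[F]_m) (g' : 'M[F]_n) : simmx g g' -> m = n.
Proof.
move=> [B [C [BC CB _]]]; apply/eqP; rewrite eqn_leq.
by rewrite -[X in (X <= n)%N](mxrank1 F) -[X in _ && (X <= m)%N](mxrank1 F)
  -BC -CB !mulmx_max_rank.
Qed.

Lemma simmx_block m n m' n' (g : 'M[F]_m) (h : 'M[F]_n) (g' : 'M[F]_m')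
    (h' : 'M[F]_n') : simmx g g' -> simmx h h' ->
  simmx (block_mx g 0 0 h) (block_mx g' 0 0 h').
Proof.
move=> [B [C [BC CB gB]]] [B' [C' [BC' CB' gB']]].
exists (block_mx B 0 0 B'), (block_mx C 0 0 C').
by split; rewrite !mulmx_block !mulmx0 !mul0mx !addr0 !add0r ?(BC, BC', CB, CB')
  -?scalar_mx_block // gB gB'.
Qed.

Definition nullity n (g : 'M[F]_n) p := (n - \rank (peval_mx g p))%N.

Lemma rank_simmx m n (g : 'M[F]_m) (g' : 'M[F]_n) p : simmx g g' ->
  \rank (peval_mx g p) = \rank (peval_mx g' p).
Proof.
move=> [B [C [BC CB gB]]]; have gpB := peval_mx_intertwine p gB.
apply/eqP; rewrite eqn_leq; apply/andP; split.
  rewrite -[peval_mx g p]mulmx1 -BC mulmxA gpB.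
  by rewrite (leq_trans (mxrankM_maxl _ _)) ?mxrankM_maxr.
rewrite -[peval_mx g' p]mul1mx -CB -mulmxA -gpB.
by rewrite (leq_trans (mxrankM_maxr _ _)) ?mxrankM_maxl.
Qed.

Lemma nullity_simmx m n (g : 'M[F]_m) (g' : 'M[F]_n) p : simmx g g' ->
  nullity g p = nullity g' p.
Proof. by move=> s; rewrite /nullity (rank_simmx p s) (simmx_size s). Qed.

Lemma peval_mx_block m n (g : 'M[F]_m) (h : 'M[F]_n) p :
  peval_mx (block_mx g 0 0 h) p = block_mx (peval_mx g p) 0 0 (peval_mx h p).
Proof.
elim/poly_ind: p => [|p c IH]; first by rewrite !linear0 block_mx0.
rewrite !rmorphD /= !peval_mxM !peval_mxX !peval_mxC IH scalar_mx_block.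
by rewrite mulmx_block add_block_mx !mulmx0 !mul0mx !addr0 !add0r.
Qed.

Lemma nullity_block m n (g : 'M[F]_m) (h : 'M[F]_n) p :
  nullity (block_mx g 0 0 h) p = (nullity g p + nullity h p)%N.
Proof.
rewrite /nullity peval_mx_block rank_diag_block_mx.
have := rank_leq_row (peval_mx g p); have := rank_leq_row (peval_mx h p).
by lia.
Qed.
End Similarity.

Lemma eq_colsP (R : Type) m n (A B : 'M[R]_(m, n)) :
  (forall j, col j A = col j B) -> A = B.
Proof. by move=> eqAB; apply/matrixP => i j; have /colP/(_ i) := eqAB j; rewrite !mxE. Qed.

Lemma col_mulmx (R : pzSemiRingType) m n p (A : 'M[R]_(m, n)) (B : 'M_(n, p)) j :
  col j (A *m B) = A *m col j B.
Proof. by apply/colP => i; rewrite !mxE; apply: eq_bigr => k _; rewrite !mxE. Qed.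

(** * Companion matrices and cyclic modules *)

Section Krylov.
Variable F : finFieldType.

(** The matrix, in the monomial basis, of the evaluation map [p |-> p(g) v] on polynomials of degree
    below [n]. *)
Definition krylov m (g : 'M[F]_m) (v : 'cV_m) n : 'M_(m, n) :=
  \matrix_(i, j) (g ^+ j *m v) i 0.

Lemma col_krylov m (g : 'M[F]_m) v n (j : 'I_n) :
  col j (krylov g v n) = g ^+ j *m v.
Proof. by apply/colP => i; rewrite !mxE. Qed.

Lemma mul_krylov m (g : 'M[F]_m) v n (p : {poly F}) : (size p <= n)%N ->
  krylov g v n *m \col_(i < n) p`_i = peval_mx g p *m v.
Proof.
move=> le; rewrite (peval_mx_wide g le) mulmx_suml; apply/colP => i.
rewrite mxE summxE; apply: eq_bigr => j _.
by rewrite -scalemxAl !mxE mulrC.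
Qed.

(** Transposed so as to act on columns: for monic [d] this is multiplication by [X] on [F[X]/(d)] in
    the monomial basis. *)
Definition compmx (d : {poly F}) : 'M[F]_((size d).-1) := (companionmx d)^T.

Lemma modp_Xn_deg (d : {poly F}) : d \is monic ->
  'X^((size d).-1) %% d = 'X^((size d).-1) - d.
Proof.
move=> dm; have sd : (0 < size d)%N by rewrite size_poly_gt0 monic_neq0.
rewrite -[X in X %% d](subrK d) modpD modpp addr0 modp_small //.
rewrite -[X in (_ < X)%N](prednK sd) ltnS; apply/leq_sizeP => k.
rewrite leq_eqVlt; case/orP => [/eqP <-|ltk]; rewrite coefB coefXn.
  by rewrite eqxx -lead_coefE (monicP dm) subrr.
by rewrite gtn_eqF // nth_default ?subrr // -(prednK sd).
Qed.

Lemma col_compmx (d : {poly F}) (j : 'I_((size d).-1)) : d \is monic ->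
  col j (compmx d) = \col_i ('X^(j.+1) %% d)`_i.
Proof.
move=> dm; apply/colP => i; rewrite !mxE.
have sd : (0 < size d)%N by rewrite size_poly_gt0 monic_neq0.
have ltj := ltn_ord j.
case: ifPn => [/eqP ej|nej].
  have -> : j.+1 = (size d).-1.
    by rewrite ej prednK // (leq_ltn_trans _ ltj).
  rewrite modp_Xn_deg //.
  rewrite coefB coefXn ltn_eqF ?sub0r //; have := ltn_ord i; lia.
rewrite modp_small ?size_polyXn ?coefXn ?[i == _ :> nat]eq_sym //.
by move: nej ltj; move: (size d) (nat_of_ord j) => ? ?; lia.
Qed.

(** The linear map [F[X]/(d) -> F^m] sending 1 to [v] commutes with [X] exactly when [d(g)] kills
    [v]; only the last column tests this. The guard covers [d = 1], where there are no columns. *)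
Lemma krylov_compmx m (g : 'M[F]_m) v (d : {poly F}) : d \is monic ->
  (g *m krylov g v _ = krylov g v _ *m compmx d) <->
  ((1 < size d)%N -> peval_mx g d *m v = 0).
Proof.
move=> dm; have d0 := monic_neq0 dm.
have colL j : col j (g *m krylov g v (size d).-1) = g ^+ j.+1 *m v.
  by rewrite col_mulmx col_krylov mulmxA exprS.
have colR j : col j (krylov g v _ *m compmx d) = peval_mx g ('X^(j.+1) %% d) *m v.
  rewrite col_mulmx col_compmx // mul_krylov // -ltnS prednK ?size_poly_gt0 //.
  by rewrite ltn_modp.
split=> [eqg sd|dv].
  have lt : ((size d).-2 < (size d).-1)%N by lia.
  have := congr1 (col (Ordinal lt)) eqg; rewrite colL colR /=.
  have -> : (size d).-2.+1 = (size d).-1 by lia.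
  rewrite modp_Xn_deg // rmorphB rmorphXn /= peval_mxX mulmxBl.
  by move=> /eqP; rewrite eq_sym subr_eq addrC -subr_eq subrr => /eqP.
apply: eq_colsP => j; have ltj := ltn_ord j.
rewrite colL colR -[X in X ^+ _ *m v](peval_mxX g) -rmorphXn /=.
rewrite [X in peval_mx g X *m v = _](divp_eq 'X^(j.+1) d).
by rewrite rmorphD rmorphM /= mulmxDl -mulmxA dv ?mulmx0 ?add0r //; lia.
Qed.

Lemma krylov_compmx1 (d : {poly F}) (lt0 : (0 < (size d).-1)%N) : d \is monic ->
  krylov (compmx d) (delta_mx (Ordinal lt0) 0) (size d).-1 = 1%:M.
Proof.
move=> dm; apply: eq_colsP => j; rewrite col_krylov col1.
case: j => j; elim: j => [|j IH] ltj.
  by rewrite expr0 mul1mx; congr (delta_mx _ _); apply: val_inj.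
have lt' := ltnW ltj; rewrite exprS -mulmxA (IH lt') -colE col_compmx //=.
apply/colP => i; rewrite modp_small ?size_polyXn; last by rewrite -ltn_predRL.
by rewrite !mxE coefXn andbT.
Qed.

(** By [krylov_compmx], [d] of the companion matrix kills the cyclic vector [e0]. It commutes with
    the matrix, so it kills the whole basis generated from [e0]. *)
Lemma peval_compmx_self (d : {poly F}) : d \is monic -> peval_mx (compmx d) d = 0.
Proof.
move=> dm; have [lt0|] := boolP (0 < (size d).-1)%N; last first.
  rewrite -eqn0Ngt => /eqP sd0; apply/matrixP => -[i lti].
  by exfalso; rewrite sd0 in lti.
pose e0 := delta_mx (Ordinal lt0) 0 : 'cV[F]_((size d).-1).
have K1 := krylov_compmx1 lt0 dm.
have /(krylov_compmx _ _ dm).1 d0 : compmx d *m krylov (compmx d) e0 _ =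
   krylov (compmx d) e0 _ *m compmx d by rewrite K1 mul1mx mulmx1.
rewrite -[LHS]mulmx1 -K1; apply: eq_colsP => j.
rewrite col_mulmx col_krylov -[X in X ^+ _ *m _](peval_mxX (compmx d)) -rmorphXn /=.
rewrite mulmxA -peval_mxM mulrC peval_mxM -mulmxA d0 ?mulmx0 ?col0 //; lia.
Qed.

Lemma peval_compmx_coef (d p : {poly F}) (lt0 : (0 < (size d).-1)%N) :
  d \is monic -> (size p <= (size d).-1)%N ->
  peval_mx (compmx d) p *m delta_mx (Ordinal lt0) 0 = \col_i p`_i :> 'cV_((size d).-1).
Proof. by move=> dm sp; rewrite -(mul_krylov _ _ sp) krylov_compmx1 // mul1mx. Qed.

(** Multiplication by [p] is injective on polynomials [u] with [deg (p u) < deg d], where no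
    reduction modulo [d] occurs. *)
Lemma rank_compmx_ge (d p : {poly F}) : d \is monic -> p != 0 ->
  (size d - size p <= \rank (peval_mx (compmx d) p))%N.
Proof.
move=> dm p0; have [lt|ge] := ltnP (size p) (size d); last first.
  by move: ge; rewrite -subn_eq0 => /eqP->.
have sp : (0 < size p)%N by rewrite size_poly_gt0.
have lt0 : (0 < (size d).-1)%N by lia.
pose e0 := delta_mx (Ordinal lt0) 0 : 'cV[F]_((size d).-1).
set Z := peval_mx (compmx d) p *m krylov (compmx d) e0 (size d - size p).
apply: leq_trans (mxrankM_maxl _ (krylov (compmx d) e0 (size d - size p))).
rewrite -mxrank_tr; suff : row_free Z^T by rewrite /row_free => /eqP->.
apply/inj_row_free => u /(congr1 trmx); rewrite trmx_mul trmxK trmx0.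
have -> : u^T = \col_i (rVpoly u)`_i.
  by apply/colP => i; rewrite !mxE coef_rVpoly_ord.
rewrite /Z -mulmxA mul_krylov ?size_poly // mulmxA -peval_mxM => Zu.
have spu : (size (p * rVpoly u)%R <= (size d).-1)%N.
  rewrite (leq_trans (size_polyMleq _ _)) //.
  have : (size (rVpoly u) <= size d - size p)%N by exact: size_poly.
  by move: lt sp; move: (rVpoly u) => ru; move: (size ru) (size p) (size d) => ? ? ?; lia.
rewrite peval_compmx_coef // in Zu.
have pu0 : p * rVpoly u = 0.
  apply/polyP => k; rewrite coef0; have [ltk|gek] := ltnP k (size d).-1.
    by have /colP/(_ (Ordinal ltk)) := Zu; rewrite !mxE.
  by rewrite nth_default // (leq_trans spu).
move/eqP: pu0; rewrite mulf_eq0 (negPf p0) /= => /eqP u0.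
by rewrite -[u]rVpolyK u0 linear0.
Qed.

(** The lower bounds for [p] and for [r] add up to the full size, while the vanishing product bounds
    the sum of the two ranks by that size. Both bounds are therefore attained. *)
Lemma rank_compmx_dvd (p r : {poly F}) : p * r \is monic -> p != 0 -> r != 0 ->
  \rank (peval_mx (compmx (p * r)) p) = (size r).-1.
Proof.
move=> dm p0 r0; have sz := size_mul p0 r0.
have := @mulmx0_rank_max _ _ _ _ (peval_mx (compmx (p * r)) p) (peval_mx (compmx (p * r)) r).
rewrite -peval_mxM peval_compmx_self // => /(_ erefl).
have := rank_compmx_ge dm p0; have := rank_compmx_ge dm r0.
have : (0 < size p)%N by rewrite size_poly_gt0.
have : (0 < size r)%N by rewrite size_poly_gt0.
move: sz; move: (\rank (peval_mx (compmx (p * r)) p)) (\rank (peval_mx _ r)).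
by move: (size (p * r)%R) (size p) (size r) => ? ? ? ? ?; lia.
Qed.

Lemma nullity_coprime n (g : 'M[F]_n) (p d : {poly F}) :
  coprimep p d -> peval_mx g d = 0 -> nullity g p = 0%N.
Proof.
move=> /Bezout_eq1_coprimepP[[u w] /= uw] gd0.
have /mulmx1_unit[_ gp] : peval_mx g u *m peval_mx g p = 1%:M.
  by rewrite -[RHS](peval_mxC g) -[1%:P]/(1 : {poly F}) -uw rmorphD !rmorphM /= gd0 mulr0 addr0.
by rewrite /nullity mxrank_unit // subnn.
Qed.

Lemma nullity_compmx_exp (r : {poly F}) i j : r \is monic ->
  nullity (compmx (r ^+ i)) (r ^+ j) = ((size r).-1 * minn i j)%N.
Proof.
move=> rm; have r0 := monic_neq0 rm; have [le_ij|lt_ji] := leqP i j.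
  rewrite /nullity -(subnKC le_ij) exprD rmorphM /= peval_compmx_self ?monic_exp //.
  by rewrite mul0r mxrank0 subn0 size_exp.
have rk k : r ^+ k != 0 by rewrite expf_neq0.
have ri : r ^+ i = r ^+ j * r ^+ (i - j) by rewrite -exprD subnKC // ltnW.
have rkE : \rank (peval_mx (compmx (r ^+ i)) (r ^+ j)) = (size (r ^+ (i - j))).-1.
  by rewrite ri rank_compmx_dvd // -ri monic_exp.
rewrite /nullity rkE !size_exp -mulnBr; congr (_ * _)%N; lia.
Qed.

Fixpoint csize (D : seq {poly F}) : nat :=
  if D is d :: D' then ((size d).-1 + csize D')%N else 0%N.

Fixpoint cdiag (D : seq {poly F}) : 'M[F]_(csize D) :=
  if D is d :: D' then block_mx (compmx d) 0 0 (cdiag D') else 0.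

Lemma nullity_cdiag D p :
  nullity (cdiag D) p = (\sum_(d <- D) nullity (compmx d) p)%N.
Proof.
elim: D => [|d D IH]; last by rewrite big_cons -IH nullity_block.
by rewrite big_nil /nullity sub0n.
Qed.

Lemma simmx_block_swap a b c (A : 'M[F]_a) (B : 'M[F]_b) (C : 'M[F]_c) :
  simmx (block_mx A 0 0 (block_mx B 0 0 C)) (block_mx B 0 0 (block_mx A 0 0 C)).
Proof.
pose S k l : 'M[F]_(k + (l + c), l + (k + c)) :=
  block_mx 0 (row_mx 1%:M 0) (col_mx 1%:M 0) (block_mx 0 0 0 1%:M).
have SS k l : S k l *m S l k = 1%:M.
  rewrite /S mulmx_block mul_row_col mul_col_row mulmx_block mul_row_block.
  rewrite mul_block_col add_block_mx.
  rewrite !mulmx0 !mul0mx !mulmx1 !addr0 !add0r.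
  by rewrite row_mx0 col_mx0 -!scalar_mx_block.
exists (S a b), (S b a); split; rewrite ?SS //.
rewrite /S !mulmx_block !mulmx0 !mul0mx !addr0 !add0r.
rewrite mul_block_col mul_row_block mul_mx_row mul_col_mx.
by rewrite !mulmx0 !mul0mx !mulmx1 !mul1mx !addr0.
Qed.

Lemma simmx_cdiag_perm D D' : perm_eq D D' -> simmx (cdiag D) (cdiag D').
Proof.
have mid d s1 s2 : simmx (cdiag (s1 ++ d :: s2)) (cdiag (d :: s1 ++ s2)).
  elim: s1 => [|e s1 IH]; first exact: simmx_refl.
  exact: simmx_trans (simmx_block (simmx_refl _) IH) (simmx_block_swap _ _ _).
elim: D D' => [|d D IH] D' eqDD'.
  by move: eqDD'; rewrite perm_sym => /perm_nilP ->; exact: simmx_refl.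
have dD' : d \in D' by rewrite -(perm_mem eqDD') mem_head.
case/splitPr: dD' eqDD' => s1 s2; rewrite perm_sym -cat1s perm_catCA perm_cons.
rewrite perm_sym => /IH sD; apply: simmx_trans (simmx_sym (mid d s1 s2)).
exact: simmx_block (simmx_refl _) sD.
Qed.
End Krylov.

(** * Existence of types *)

Section Existence.
Variable F : finFieldType.
Implicit Types (p r d : {poly F}).

Lemma irreducible_monic_dvd p : (1 < size p)%N ->
  exists r, [/\ irreducible_poly r, r \is monic & r %| p].
Proof.
elim: {p}(size p) {-2}p (leqnn (size p)) => [|n IH] p; first by case: (size p).
move=> le_pn sp; have p0 : p != 0 by rewrite -size_poly_gt0 (ltn_trans _ sp).
have [[s [ss sd nes]]|irr] := EM (exists s : {poly F}, [/\ size s != 1%N, s %| p & ~~ (s %= p)]).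
  have s0 : s != 0 by apply: contraNneq p0 => s0; rewrite s0 dvd0p in sd.
  have lts : (size s < size p)%N.
    by rewrite ltn_neqAle dvdp_leq // andbT dvdp_size_eqp.
  have [//||r [ir mr rs]] := IH s; first by rewrite -ltnS (leq_trans lts).
    by rewrite ltn_neqAle eq_sym ss size_poly_gt0.
  by exists r; split=> //; exact: dvdp_trans rs sd.
have lc : lead_coef p != 0 by rewrite lead_coef_eq0.
exists ((lead_coef p)^-1 *: p); split.
- split; first by rewrite size_scale ?invr_eq0.
  move=> s ss; rewrite dvdpZr ?invr_eq0 // => sd.
  rewrite (eqp_rtrans (eqp_scale p _)) ?invr_eq0 //.
  by apply/negPn/negP => ne; apply: irr; exists s.
- by rewrite monicE lead_coefZ mulVf.
- by rewrite dvdpZl ?invr_eq0 // dvdpp.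
Qed.

Lemma irreducible_multiplicity r p : irreducible_poly r -> p != 0 ->
  exists i s, p = r ^+ i * s /\ coprimep r s.
Proof.
move=> ir p0; have r1 : (1 < size r)%N by case: ir.
pose P i := r ^+ i %| p.
have P0 : exists i, P i by exists 0%N; rewrite /P expr0 dvd1p.
have Pb i : P i -> (i <= size p)%N.
  move=> /(dvdp_leq p0); apply: leq_trans.
  have := size_exp r i; move: r1; move: (size (r ^+ i)%R) (size r) => a b; nia.
case: (ex_maxnP P0 Pb) => i /dvdpP[s sE] maxi; exists i, s; split; first by rewrite mulrC.
rewrite irreducible_poly_coprime //; apply/negP => rs; have := maxi i.+1.
by rewrite ltnn /P sE exprS dvdp_mul // => /(_ isT).
Qed.

Lemma mulmx_krylov m n (g : 'M[F]_m) (g' : 'M[F]_n) (A : 'M_(n, m)) v k :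
  g' *m A = A *m g -> A *m krylov g v k = krylov g' (A *m v) k.
Proof.
move=> gA; apply: eq_colsP => j; rewrite col_mulmx !col_krylov !mulmxA.
by have := peval_mx_intertwine 'X^j gA; rewrite !rmorphXn /= !peval_mxX => <-.
Qed.

Lemma rank_factorization m n (A : 'M[F]_(m, n)) :
  exists (k : nat) (W : 'M_(m, k)) (G : 'M_(k, n)) W' G',
    [/\ k = \rank A, W *m G = A, W' *m W = 1%:M & G *m G' = 1%:M].
Proof.
have /row_fullP[W' W'W] := col_base_full A.
have /row_freeP[G' GG'] := row_base_free A.
by exists (\rank A), (col_base A), (row_base A), W', G'; split; rewrite ?mulmx_base.
Qed.

(* With [r ^ i] the exact power of [r] in the minimal polynomial [r ^ i * s],
   the functional [phi] and the vector [v] are both killed by [r ^ i] while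
   [phi (r ^ (i - 1)) v <> 0]. Hence the pairing [(f, h) |-> phi (f h)(g) v] on
   [F[t] / (r ^ i)] is perfect, and the vectors orthogonal to all [phi g ^ j]
   form an invariant complement of the cyclic space of [v]. *)
Lemma simmx_split n (g : 'M[F]_n.+1) : exists r i k (g' : 'M[F]_k),
  [/\ irreducible_poly r, r \is monic, (0 < i)%N &
      simmx g (block_mx (compmx (r ^+ i)) 0 0 g')].
Proof.
pose p := mxminpoly g; have pm : p \is monic by exact: mxminpoly_monic.
have sp : (1 < size p)%N by rewrite size_mxminpoly ltnS mxminpoly_nonconstant.
have [r [ir rm rp]] := irreducible_monic_dvd sp.
have r1 : (1 < size r)%N by case: ir.
have [i [s [pE co_rs]]] := irreducible_multiplicity ir (monic_neq0 pm).
have i_gt0 : (0 < i)%N.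
  rewrite lt0n; apply: contraTneq rp => i0; rewrite pE i0 expr0 mul1r.
  by rewrite -irreducible_poly_coprime.
pose d := r ^+ i; have dm : d \is monic by exact: monic_exp.
have d0 := monic_neq0 dm.
have gp0 : peval_mx g p = 0 by rewrite peval_mxE; exact/mxminpoly_minP.
(* If [s * s * r ^+ i.-1] killed [g], the minimal polynomial would divide it, and coprimality with
   [s] would make [r ^+ i] divide [r ^+ i.-1]. The position of a nonzero entry then yields [phi] and
   [v]. *)
have /matrix0Pn[a [b nz]] : peval_mx g (s * s * r ^+ i.-1) != 0.
  apply/negP => /eqP; rewrite peval_mxE => /mxminpoly_minP; rewrite -/p pE.
  have co : coprimep (r ^+ i) (s * s) by rewrite coprimepMr coprimep_expl.
  move=> /(dvdp_trans (dvdp_mulr s (dvdpp _))); rewrite Gauss_dvdpr //.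
  by rewrite dvdp_Pexp2l // leqNgt prednK // leqnn.
pose phi : 'rV_n.+1 := delta_mx 0 a *m peval_mx g s.
pose v : 'cV_n.+1 := peval_mx g s *m delta_mx b 0.
have phiv : phi *m peval_mx g (r ^+ i.-1) *m v != 0.
  have -> : phi *m peval_mx g (r ^+ i.-1) *m v =
      delta_mx 0 a *m peval_mx g (s * s * r ^+ i.-1) *m delta_mx b 0.
    by rewrite (mulrAC s) !peval_mxM /phi /v !mulmxA.
  apply: contraNneq nz => /matrixP/(_ 0 0).
  by rewrite -rowE -colE !mxE => ->.
have dv : peval_mx g d *m v = 0.
  by rewrite /v mulmxA -peval_mxM -pE gp0 mul0mx.
have phid : phi *m peval_mx g d = 0.
  by rewrite /phi -mulmxA -peval_mxM mulrC -pE gp0 mulmx0.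
pose N := (size d).-1.
have size_mod f : (size (f %% d)%R <= N)%N.
  by rewrite -ltnS /N prednK ?size_poly_gt0 // ltn_modp.
pose B := krylov g v N; pose C : 'M_(N, n.+1) := \matrix_j (phi *m g ^+ j).
have gB : g *m B = B *m compmx d by apply/krylov_compmx.
have CE (u : 'rV_N) : u *m C = phi *m peval_mx g (rVpoly u).
  rewrite (@peval_mx_wide _ _ _ _ N) ?size_poly // mulmx_sumr mulmx_sum_row.
  apply: eq_bigr => j _; rewrite rowK coef_rVpoly_ord.
  by rewrite -[_ *: _ ^+ _]mul_scalar_mx mulmxA mul_mx_scalar -scalemxAl.
have reduceB (x : 'rV_n.+1) : x *m B = 0 -> forall h, x *m peval_mx g h *m v = 0.
  move=> xB h; rewrite (divp_eq h d) rmorphD /= peval_mxM mulmxDr mulmxDl.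
  rewrite -!mulmxA dv !mulmx0 add0r -(mul_krylov _ _ (size_mod h)) mulmxA.
  by rewrite -/B xB mul0mx.
have reduceC k (x : 'M_(n.+1, k)) : C *m x = 0 -> forall h, phi *m peval_mx g h *m x = 0.
  move=> Cx h; rewrite (divp_eq h d) mulrC rmorphD /= peval_mxM mulmxDr mulmxDl.
  rewrite mulmxA phid !mul0mx add0r.
  have -> : h %% d = rVpoly (poly_rV (h %% d) : 'rV_N) by rewrite poly_rV_K.
  by rewrite -CE -mulmxA Cx mulmx0.
(* This is the Gram matrix of the pairing in the monomial basis. *)
have CB_unit : C *m B \in unitmx.
  rewrite -row_free_unit; apply/inj_row_free => u; rewrite mulmxA CE => uB.
  have {}uB := reduceB _ uB; have [f0|f0] := eqVneq (rVpoly u) 0.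
    by rewrite -[u]rVpolyK f0 linear0.
  have [j [f' [fE co_rf]]] := irreducible_multiplicity ir f0.
  have ltji : (j < i)%N.
    rewrite ltnNge; apply/negP => leij.
    have : d %| rVpoly u by rewrite fE dvdp_mulr // dvdp_exp2l.
    move=> /(dvdp_leq f0); apply/negP; rewrite -ltnNge.
    rewrite -[X in (_ < X)%N](@prednK (size d)) ?size_poly_gt0 // ltnS.
    exact: size_poly.
  have /Bezout_eq1_coprimepP[[w w'] /= ww'] : coprimep (r ^+ i) f'.
    exact: coprimep_expl.
  (* Modulo [d], [w'] inverts [f'], so this multiplier turns [rVpoly u] into [r ^+ i.-1] up to a
     multiple of [d], which kills [v]. *)
  case/eqP: phiv; have := uB (w' * r ^+ (i.-1 - j)).
  rewrite -[X in X *m v = 0]mulmxA -peval_mxM fE.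
  have -> : r ^+ j * f' * (w' * r ^+ (i.-1 - j)) = r ^+ i.-1 * (1 - w * d).
    have -> : 1 - w * d = w' * f' by rewrite -ww' /d addrAC subrr add0r.
    have -> : r ^+ i.-1 = r ^+ j * r ^+ (i.-1 - j).
      by rewrite -exprD subnKC // -ltnS prednK.
    by ring.
  rewrite mulrBr mulr1 mulrA rmorphB /= (peval_mxM _ _ d) mulmxBr mulmxBl.
  by rewrite -!mulmxA dv !mulmx0 subr0.
pose E := invmx (C *m B) *m C.
have EB : E *m B = 1%:M by rewrite /E -mulmxA mulVmx.
(* [B *m E] projects onto the cyclic space along the kernel of [C]. The rank factorisation of the
   complementary projection [e] supplies a basis of that kernel. *)
pose e : 'M_n.+1 := 1%:M - B *m E.
have eB : e *m B = 0 by rewrite mulmxBl mul1mx -mulmxA EB mulmx1 subrr.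
have Ee : E *m e = 0 by rewrite mulmxBr mulmx1 mulmxA EB mul1mx subrr.
have ee : e *m e = e by rewrite {2}/e mulmxBr mulmx1 mulmxA eB mul0mx subr0.
have [k [W [G [W' [G' [_ WG W'W GG']]]]]] := rank_factorization e.
have GW : G *m W = 1%:M.
  have : W' *m (W *m G *m (W *m G)) *m G' = 1%:M.
    by rewrite WG ee -WG mulmxA W'W mul1mx GG'.
  by rewrite !mulmxA W'W mul1mx -!mulmxA GG' mulmx1.
have EW : E *m W = 0 by rewrite -[W]mulmx1 -GG' [W *m _]mulmxA WG mulmxA Ee mul0mx.
have GB : G *m B = 0 by rewrite -[G]mul1mx -W'W -[_ *m G]mulmxA WG -mulmxA eB mulmx0.
have CW : C *m W = 0.
  by rewrite -[C]mul1mx -(mulmxV CB_unit) -[_ *m C]mulmxA -/E -mulmxA EW mulmx0.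
(* The complement is invariant: modulo [d], each functional [phi g^(j+1)] is a combination of the
   rows of [C]. *)
have EgW : E *m (g *m W) = 0.
  rewrite /E -mulmxA; have -> : C *m (g *m W) = 0; last by rewrite mulmx0.
  apply/row_matrixP => j; rewrite row_mul rowK row0.
  have := reduceC _ _ CW ('X^j * 'X); rewrite peval_mxM rmorphXn /= peval_mxX.
  by rewrite !mulmxA.
exists r, i, k, (G *m g *m W); split=> //.
exists (row_mx B W), (col_mx E G); split.
- by rewrite mul_row_col WG /e addrC subrK.
- by rewrite mul_col_row EB EW GB GW -scalar_mx_block.
rewrite mul_mx_row mul_row_block !mulmx0 addr0 add0r -/d gB; congr row_mx.
have BEWG : B *m E + W *m G = 1%:M by rewrite WG /e addrC subrK.
rewrite -[LHS]mul1mx -BEWG mulmxDl -mulmxA EgW mulmx0 add0r.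
by rewrite !mulmxA.
Qed.
End Existence.

(** * Types as similarity classes of companion block matrices *)

Section Bridge.
Variable F : finFieldType.
Implicit Types (D : seq {poly F}) (tau : modtype F).

(** The matrix of the map from the direct sum of the [F[t]/(d_l)] to [F^n] that sends the [l]-th
    generator to the [l]-th vector. *)
Fixpoint kmx n (g : 'M[F]_n) D (vs : seq 'cV[F]_n) : 'M_(n, csize D) :=
  if D is d :: D' then row_mx (krylov g (head 0 vs) (size d).-1) (kmx g D' (behead vs))
  else 0.

Lemma cols_row_mx n k l (A : 'M[F]_(n, k)) (B : 'M[F]_(n, l)) :
  [seq col j (row_mx A B) | j <- enum 'I_(k + l)] =
  [seq col j A | j <- enum 'I_k] ++ [seq col j B | j <- enum 'I_l].
Proof.
have S d (M : 'M[F]_(n, d)) : size [seq col j M | j <- enum 'I_d] = d.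
  by rewrite size_map size_enum_ord.
apply: (@eq_from_nth _ 0) => [|i]; rewrite ?size_cat !S // => lti.
rewrite nth_cat S (nth_map (Ordinal lti)) ?size_enum_ord //.
have [ltik|geik] := ltnP i k.
  rewrite (nth_map (Ordinal ltik)) ?size_enum_ord // -(colKl _ A B).
  by congr (col _ _); apply: val_inj; rewrite /= !nth_enum_ord.
have lti' : (i - k < l)%N by rewrite ltn_subLR.
rewrite (nth_map (Ordinal lti')) ?size_enum_ord // -(colKr _ A B).
by congr (col _ _); apply: val_inj; rewrite /= !nth_enum_ord // subnKC.
Qed.

Lemma kmx_cols n (g : 'M[F]_n) D vs : size vs = size D ->
  flatten [seq [seq g ^+ j *m dv.2 | j <- iota 0 (size dv.1).-1]
     | dv : {poly F} * 'cV[F]_n <- zip D vs] =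
  [seq col j (kmx g D vs) | j <- enum 'I_(csize D)].
Proof.
elim: D vs => [|d D IH] [|v vs] //=.
  by move=> _; apply/esym/size0nil; rewrite size_map size_enum_ord.
move=> [/IH svs]; rewrite cols_row_mx svs; congr (_ ++ _).
rewrite -val_enum_ord -map_comp; apply: eq_map => j /=.
by rewrite col_krylov.
Qed.

Lemma basis_cols n k (A : 'M[F]_(n, k)) :
  basis_of fullv [seq col j A | j <- enum 'I_k] <->
  exists C, A *m C = 1%:M /\ C *m A = 1%:M.
Proof.
pose X := [tuple col j A | j < k].
have -> : [seq col j A | j <- enum 'I_k] = X by rewrite -(val_ord_tuple k).
have XE (j : 'I_k) : X`_j = col j A by rewrite -tnth_nth tnth_mktuple.
have sumE (c : 'I_k -> F) : \sum_(i < k) c i *: X`_i = A *m \col_i c i.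
  apply/colP => i; rewrite summxE mxE; apply: eq_bigr => j _.
  by rewrite XE !mxE mulrC.
split=> [bX|[C [AC CA]]].
  have kn : n = k by have := size_basis bX; rewrite dimvf /dim /= muln1.
  have /freeP fX := basis_free bX; subst n.
  have Au : A^T \in unitmx.
    rewrite -row_free_unit; apply/inj_row_free => u /(congr1 trmx).
    rewrite trmx_mul trmxK trmx0 => Au0; apply/rowP => i; rewrite mxE.
    apply: (fX (fun i => u 0 i)); rewrite sumE -Au0; congr (_ *m _).
    by apply/colP => j; rewrite !mxE.
  by rewrite unitmx_tr in Au; exists (invmx A); rewrite mulmxV ?mulVmx.
rewrite basisEfree subvf dimvf size_tuple [dim _]muln1.
have nk : (n <= k)%N.
  by rewrite -(mxrank1 F n) -AC (leq_trans (mxrankM_maxl A C)) ?rank_leq_col.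
rewrite nk !andbT; apply/freeP => c; rewrite sumE => /(congr1 (mulmx C)).
by rewrite mulmxA CA mul1mx mulmx0 => /colP c0 i; have := c0 i; rewrite !mxE.
Qed.

Definition nontrivial_monic D := all (fun d : {poly F} => (d \is monic) && (1 < size d)%N) D.

Lemma kmx_intertwine n (g : 'M[F]_n) D vs : nontrivial_monic D -> size vs = size D ->
  (forall l, (l < size D)%N -> peval_mx g D`_l *m vs`_l = 0) <->
  g *m kmx g D vs = kmx g D vs *m cdiag D.
Proof.
elim: D vs => [|d D IH] [|v vs] //=; first by move=> _ _; split=> //; rewrite !mulmx0.
case/andP=> /andP[dm sd] /IH{}IH [/IH{}IH].
rewrite mul_mx_row mul_row_block !mulmx0 addr0 add0r; split=> [H|/eq_row_mx[H1 H2]].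
  congr row_mx; first by apply/krylov_compmx => // _; exact: (H 0%N).
  by apply/IH => l ltl; exact: (H l.+1).
move=> [_|l ltl] /=; last by move/IH: H2 => /(_ l ltl).
by move/(krylov_compmx _ _ dm): H1; apply.
Qed.

(** A module map out of a sum of cyclic modules is determined by the images of the generators, which
    sit in the first column of each block. *)
Lemma kmx_surj n (g : 'M[F]_n) D (B : 'M_(n, csize D)) : nontrivial_monic D ->
  g *m B = B *m cdiag D -> exists2 vs, size vs = size D & B = kmx g D vs.
Proof.
elim: D B => [|d D IH] B /=.
  by move=> _ _; exists [::] => //; exact: thinmx0.
case/andP=> /andP[dm sd] /IH{}IH; rewrite -[B]hsubmxK.
rewrite mul_mx_row mul_row_block !mulmx0 addr0 add0r => /eq_row_mx[g1 /IH[vs svs ->]].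
have lt0 : (0 < (size d).-1)%N by rewrite ltn_predRL.
exists (lsubmx B *m delta_mx (Ordinal lt0) 0 :: vs) => /=; first by rewrite svs.
by rewrite -(mulmx_krylov _ _ g1) krylov_compmx1 // mulmx1.
Qed.

Definition part tau (r : {poly F}) : seq nat := odflt [::] tau.[? r]%fmap.

Lemma elem_divsE tau :
  elem_divs tau = flatten [seq [seq r ^+ i | i <- part tau r] | r <- domf tau].
Proof. by []. Qed.

Lemma nontrivial_elem_divs tau : is_modtype tau -> nontrivial_monic (elem_divs tau).
Proof.
move=> tauP; apply/allP => d /flatten_mapP[r rtau /mapP[i ii ->]].
have [[[r1 _] rm _] [/andP[_ /allP pos] _]] := tauP r rtau.
rewrite monic_exp //= -ltn_predRL size_exp muln_gt0 ltn_predRL r1.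
exact: pos.
Qed.

(** The vectors witnessing a type amount to an invertible intertwiner: annihilation is the
    intertwining relation, and the basis condition is invertibility. *)
Lemma has_typeP n (g : 'M[F]_n) tau :
  has_type g tau <-> is_modtype tau /\ simmx g (cdiag (elem_divs tau)).
Proof.
split=> [[tauP [vs /= [svs ann bas]]]|[tauP [B [C [BC CB gB]]]]]; split=> //.
  move: bas; rewrite kmx_cols // => /basis_cols[C [BC CB]].
  exists (kmx g (elem_divs tau) vs), C; split=> //.
  by apply/kmx_intertwine => //; exact: nontrivial_elem_divs.
have nD := nontrivial_elem_divs tauP.
have [vs svs BE] := kmx_surj nD gB; exists vs => /=; split=> //.
  by apply/kmx_intertwine => //; rewrite -BE.
by rewrite kmx_cols // -BE; apply/basis_cols; exists C.
Qed.
End Bridge.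

(** * Uniqueness of types *)

Section Types.
Variable F : finFieldType.
Implicit Types (r p : {poly F}) (tau : modtype F).

Lemma in_Phi_coprime r r' : in_Phi r -> in_Phi r' -> r != r' -> coprimep r r'.
Proof.
move=> [ir rm _] [ir' rm' _]; rewrite irreducible_poly_coprime //.
apply: contraNN => rr'; rewrite -eqp_monic //; apply: ir'.2 => //.
by rewrite gtn_eqF //; case: ir.
Qed.

Lemma nullity_has_type n (g : 'M[F]_n) tau r j : has_type g tau -> in_Phi r ->
  nullity g (r ^+ j) = (\sum_(i <- part tau r) (size r).-1 * minn i j)%N.
Proof.
move=> /has_typeP[tauP sg] rP; rewrite (nullity_simmx _ sg) nullity_cdiag.
rewrite elem_divsE big_flatten big_map /=.
have other r' : r' \in domf tau -> r' != r ->
    (\sum_(d <- [seq r' ^+ i | i <- part tau r']) nullity (compmx d) (r ^+ j) = 0)%N.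
  move=> r't ne; rewrite big_map big1 // => i _.
  have r'P := (tauP _ r't).1; apply: (@nullity_coprime _ _ _ _ (r' ^+ i)).
    by rewrite coprimep_expl // coprimep_expr // in_Phi_coprime // eq_sym.
  by apply: peval_compmx_self; rewrite monic_exp; case: r'P.
have [rt|rt] := boolP (r \in domf tau); last first.
  rewrite /part not_fnd //= big_nil big1_seq // => r' /= r't.
  by apply: other => //; apply: contraNneq rt => <-.
rewrite (bigD1_seq r) ?fset_uniq //= [X in (_ + X)%N]big1_seq ?addn0 => [|r' /andP[ne r't]].
  by rewrite big_map; apply: eq_bigr => i _; rewrite nullity_compmx_exp //; case: rP.
exact: other.
Qed.

(** As [minn i j.+1 - minn i j] is 1 or 0 according to [j < i], successive nullities count the parts
    exceeding [j]; these counts determine the type. *)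
Lemma nullity_has_typeS n (g : 'M[F]_n) tau r j : has_type g tau -> in_Phi r ->
  nullity g (r ^+ j.+1) =
  (nullity g (r ^+ j) + (size r).-1 * count (fun i => j < i)%N (part tau r))%N.
Proof.
move=> gt rP; rewrite !(nullity_has_type _ gt rP).
elim: (part tau r) => [|i s IH]; first by rewrite !big_nil muln0.
rewrite !big_cons IH /=.
have -> : minn i j.+1 = (minn i j + (j < i))%N by lia.
by rewrite !mulnDr; lia.
Qed.

Lemma partition_eq (s t : seq nat) : is_partition s -> is_partition t ->
  (forall j, count (fun i => j < i)%N s = count (fun i => j < i)%N t) -> s = t.
Proof.
move=> /andP[ss /allP s0] /andP[ts /allP t0] st.
apply: (sorted_eq (leT := geq)) => //.
- by move=> a b c /= ab bc; exact: leq_trans ab.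
- by move=> a b /=; rewrite andbC -eqn_leq => /eqP.
have cntE u j :
    (count (fun i => j < i) u = count (fun i => j.+1 < i) u + count_mem j.+1 u)%N.
  by elim: u => //= a u ->; case: (ltngtP a j.+1); lia.
apply/allP => -[_|j _] /=; last by have := st j; rewrite (cntE s j) (cntE t j) st => /addnI ->.
rewrite (count_memPn _); first by rewrite (count_memPn _) //; apply/negP => /t0.
by apply/negP => /s0.
Qed.

(** The domains agree as well, since only nonempty partitions are stored. *)
Lemma modtype_eq (s t : modtype F) : is_modtype s -> is_modtype t ->
  (forall r, in_Phi r -> part s r = part t r) -> s = t.
Proof.
move=> sP tP eqst; apply/fmapP => r.
have [[rs|rs] [rt|rt]] := (boolP (r \in domf s), boolP (r \in domf t)).
- have [rP _] := sP r rs; have := eqst r rP; rewrite /part.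
  by rewrite !in_fnd /= => ->.
- have [rP [_ /eqP]] := sP r rs; have := eqst r rP.
  by rewrite /part (not_fnd rt) /= => ->.
- have [rP [_ /eqP]] := tP r rt; have := eqst r rP.
  by rewrite /part (not_fnd rs) /= => <-.
by rewrite !not_fnd.
Qed.

Lemma part_partition tau r : is_modtype tau -> is_partition (part tau r).
Proof.
move=> tauP; have [rt|rt] := boolP (r \in domf tau); first by case: (tauP r rt) => _ [].
by rewrite /part not_fnd.
Qed.

Lemma modtype_eq_count (s t : modtype F) : is_modtype s -> is_modtype t ->
  (forall r j, in_Phi r ->
     count (fun i => j < i)%N (part s r) = count (fun i => j < i)%N (part t r)) -> s = t.
Proof.
move=> sP tP st; apply: modtype_eq => // r rP.
by apply: partition_eq => [||j]; rewrite ?part_partition ?st.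
Qed.

Lemma in_Phi_size r : in_Phi r -> (0 < (size r).-1)%N.
Proof. by case=> -[r1 _] _ _; rewrite ltn_predRL. Qed.

Lemma has_type_uniq n (g : 'M[F]_n) s t : has_type g s -> has_type g t -> s = t.
Proof.
move=> gs gt; have [sP _] := gs; have [tP _] := gt.
apply: modtype_eq_count => // r j rP.
have := nullity_has_typeS j gs rP; rewrite (nullity_has_typeS j gt rP).
by move=> /addnI/eqP; rewrite eqn_pmul2l ?in_Phi_size // => /eqP.
Qed.

Lemma simmx_cdiag_exists n (g : 'M[F]_n) : exists ds : seq ({poly F} * nat),
  (forall x, x \in ds -> [/\ irreducible_poly x.1, x.1 \is monic & (0 < x.2)%N]) /\
  simmx g (cdiag [seq x.1 ^+ x.2 | x <- ds]).
Proof.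
elim/ltn_ind: n g => -[|n] IH g.
  exists [::]; split=> //; have -> : g = cdiag [::] by apply: mx0_eq.
  exact: simmx_refl.
have [r [i [k [g' [ir rm i_gt0 sg]]]]] := simmx_split g.
have ltk : (k < n.+1)%N.
  rewrite (simmx_size sg) -[X in (X < _)%N]add0n ltn_add2r size_exp muln_gt0 i_gt0 andbT.
  by case: ir; rewrite ltn_predRL.
have [ds [dsP sg']] := IH k ltk g'; exists ((r, i) :: ds); split.
  by move=> x; rewrite inE => /predU1P[->|/dsP].
exact: simmx_trans sg (simmx_block (simmx_refl _) sg').
Qed.

Definition modtype_of (ds : seq ({poly F} * nat)) : modtype F :=
  [fmap r : [fset x.1 | x in ds]%fset =>
    sort geq [seq x.2 | x <- ds & x.1 == val r]].

Lemma part_modtype_of ds r : part (modtype_of ds) r = sort geq [seq x.2 | x <- ds & x.1 == r].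
Proof.
rewrite /part; have [rd|rd] := boolP (r \in domf (modtype_of ds)).
  by rewrite in_fnd /= ffunE.
rewrite not_fnd //=; case E: [seq _ | _ <- _ & _] => [|a l] //.
exfalso; move/negP: rd; apply; rewrite /=.
have /mapP[x] : a \in [seq x.2 | x <- ds & x.1 == r] by rewrite E mem_head.
rewrite mem_filter => /andP[/eqP <- xd] _; apply/imfsetP; exists x => //.
Qed.

Lemma has_type_exists n (g : 'M[F]_n) : g \in unitmx -> exists tau, has_type g tau.
Proof.
move=> gu; have [ds [dsP sg]] := simmx_cdiag_exists g.
exists (modtype_of ds); apply/has_typeP; split.
  move=> r /imfsetP[x /= xd ->]; have [ir rm x2] := dsP x xd.
  have xpart : x.2 \in part (modtype_of ds) x.1.
    by rewrite part_modtype_of mem_sort; apply/mapP; exists x; rewrite ?mem_filter ?eqxx.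
  split; last split.
  (* An elementary divisor that is a power of ['X] would give [g] a nonzero kernel, against
     invertibility. *)
  - split=> //; apply: contraTneq x2 => xX; rewrite -leqNgt.
    have : nullity g 'X = 0%N by rewrite /nullity peval_mxX mxrank_unit // subnn.
    rewrite (nullity_simmx _ sg) nullity_cdiag big_map (big_rem x) //= -xX.
    have := nullity_compmx_exp x.2 1 rm; rewrite expr1 => ->.
    by rewrite xX size_polyX mul1n; case: (x.2).
  - rewrite -/(part _ _) /is_partition part_modtype_of sort_sorted //=; last first.
      by move=> a b; exact: leq_total.
    apply/allP => i; rewrite mem_sort => /mapP[y]; rewrite mem_filter => /andP[_ /dsP[_ _ ?]].
    by move=> ->.
  - by apply/eqP => p0; move: xpart; rewrite /part p0.
apply: simmx_trans sg (simmx_cdiag_perm _).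
apply/permP => a; rewrite elem_divsE count_flatten -map_comp count_map.
rewrite sumnE big_map /=.
(* A double sum over bases [r] and pairs [x], in which each pair counts only at [r = x.1]. *)
transitivity (\sum_(r <- domf (modtype_of ds)) \sum_(x <- ds) ((x.1 == r) * a (x.1 ^+ x.2)))%N.
  rewrite exchange_big -sum1_count big_mkcond /=; apply: eq_big_seq => x xd.
  rewrite (bigD1_seq x.1) ?fset_uniq //=; last by apply/imfsetP; exists x.
  rewrite eqxx mul1n big1 ?addn0 => [|r /negPf]; last by rewrite eq_sym => ->.
  by case: (a _).
apply: eq_bigr => r _; rewrite part_modtype_of count_map.
have /permP -> : perm_eq (sort geq [seq x.2 | x <- ds & x.1 == r]) [seq x.2 | x <- ds & x.1 == r].
  by rewrite perm_sort.
rewrite count_map count_filter -sum1_count [RHS]big_mkcond /=; apply: eq_bigr => x _.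
by case: eqP => [->|]; rewrite ?andbT ?andbF //=; case: (a _).
Qed.
End Types.

(** * The core of a matrix *)

Section Core.
Variable F : finFieldType.

Lemma in_Phi_Xsub1 : in_Phi ('X - 1 : {poly F}).
Proof.
split; rewrite -?polyC1; [exact: irredp_XsubC|exact: monicXsubC|].
apply/eqP => /polyP/(_ 0%N); rewrite coefB coefX coefC /= sub0r => /eqP.
by rewrite oppr_eq0 oner_eq0.
Qed.

Section PQ.
Variables (m k : nat) (P : 'M[F]_(m, k)) (Q : 'M[F]_(k, m)).

(** Right multiplication by [P] carries the left kernel of [p(a)] into that of [p(c)]. It is
    injective there, because the Bezout relation makes [P Q w(a)] the identity on that kernel. *)
Lemma nullity_core_le p : coprimep p ('X - 1) ->
  (nullity (1%:M + P *m Q) p <= nullity (1%:M + Q *m P) p)%N.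
Proof.
set a := 1%:M + P *m Q; set c := 1%:M + Q *m P.
have aX : peval_mx a ('X - 1) = P *m Q.
  by rewrite rmorphB rmorph1 /= peval_mxX /a addrAC subrr add0r.
move=> /Bezout_eq1_coprimepP[[u w] /= uw].
have aP : a *m P = P *m c by rewrite mulmxDl mulmxDr mul1mx mulmx1 mulmxA.
pose Z := kermx (peval_mx a p).
have Zp : Z *m peval_mx a p = 0 by exact: mulmx_ker.
have ZP : (Z *m P) *m peval_mx c p = 0.
  by rewrite -mulmxA -(peval_mx_intertwine p aP) mulmxA Zp mul0mx.
have ZE : Z = Z *m P *m (Q *m peval_mx a w).
  have p1 : peval_mx a 1 = 1%:M by rewrite -polyC1 peval_mxC.
  rewrite -{1}[Z]mulmx1 -p1 -uw [u * p]mulrC [w * _]mulrC.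
  by rewrite rmorphD /= !peval_mxM aX mulmxDr mulmxA Zp mul0mx add0r !mulmxA.
have := mulmx0_rank_max ZP; rewrite /nullity -mxrank_ker -/Z.
have : (\rank Z <= \rank (Z *m P))%N by rewrite {1}ZE mxrankM_maxl.
lia.
Qed.

End PQ.

Lemma nullity_core m k (P : 'M[F]_(m, k)) (Q : 'M[F]_(k, m)) p : coprimep p ('X - 1) ->
  nullity (1%:M + P *m Q) p = nullity (1%:M + Q *m P) p.
Proof. by move=> co; apply/eqP; rewrite eqn_leq !nullity_core_le. Qed.

Lemma rank_mulmx_inj m n k l (A : 'M[F]_(m, k)) A' (M : 'M[F]_(k, l)) (B : 'M[F]_(l, n)) B' :
  A' *m A = 1%:M -> B *m B' = 1%:M -> \rank (A *m M *m B) = \rank M.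
Proof.
move=> A'A BB'; apply/eqP; rewrite eqn_leq; apply/andP; split.
  by rewrite (leq_trans (mxrankM_maxl _ _)) ?mxrankM_maxr.
have {1}-> : M = A' *m (A *m M *m B) *m B'.
  by rewrite !mulmxA A'A mul1mx -mulmxA BB' mulmx1.
by rewrite (leq_trans (mxrankM_maxl _ _)) ?mxrankM_maxr.
Qed.

Lemma part_modify (tau : modtype F) r : part (modify tau) r =
  if r == 'X - 1 then [seq i.-1 | i <- part tau r & (1 < i)%N] else part tau r.
Proof.
rewrite /modify /part; set p := [seq _ | _ <- _ & _].
case: eqVneq => [->|ne].
  by rewrite -/p; case: (p) => [|a l]; rewrite ?fnd_rem1 ?eqxx // fnd_set eqxx.
by case: (p) => [|a l]; rewrite ?fnd_rem1 ?ne // fnd_set (negPf ne).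
Qed.

Lemma is_modtype_modify (tau : modtype F) : is_modtype tau -> is_modtype (modify tau).
Proof.
move=> tauP r rt.
have ne : part (modify tau) r != [::] /\ in_Phi r.
  move: rt (part_modify tau r); rewrite /modify.
  set p := [seq _ | _ <- _ & _]; case E: p => [|a l].
    rewrite domf_rem !inE => /andP[/negPf ne rt]; rewrite ne.
    by have [rP [_ nz]] := tauP r rt => ->.
  rewrite dom_setf !inE => /predU1P[->|rt].
    by rewrite eqxx -/p E => ->; split=> //; exact: in_Phi_Xsub1.
  have [rP [_ nz]] := tauP r rt; case: eqP => [rX|_] -> //.
  by rewrite rX -/p E -rX.
split; [by case: ne|split; last by case: ne].
rewrite -/(part _ _) part_modify; case: eqP => _; last exact: part_partition.
have /andP[st _] := part_partition r tauP; apply/andP; split.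
  have geq_tr : transitive geq by move=> b a c /= ab bc; exact: leq_trans ab.
  rewrite sorted_map; apply: sub_sorted (sorted_filter geq_tr _ st).
  move=> a b; rewrite /geq /= => ba; lia.
apply/allP => y /mapP[i]; rewrite mem_filter => /andP[i1 _] ->.
by rewrite -ltnS prednK // ltnW.
Qed.

(** Away from ['X - 1] the nullities of [1 + P Q] and [1 + Q P] agree. At ['X - 1],
    [(P Q)^(j+1) = P (Q P)^j Q] has the rank of [(Q P)^j]; this shift by one is the subtraction of 1
    from each part. *)
Lemma has_type_core m k (P : 'M[F]_(m, k)) (Q : 'M[F]_(k, m)) P' Q' tau :
  P' *m P = 1%:M -> Q *m Q' = 1%:M -> 1%:M + P *m Q \in unitmx ->
  has_type (1%:M + P *m Q) tau -> has_type (1%:M + Q *m P) (modify tau).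
Proof.
move=> P'P QQ' au at_; have [tauP _] := at_.
have cu : 1%:M + Q *m P \in unitmx.
  (* A left kernel vector [x] of the core yields the left kernel vector [x *m Q] of [1 + P Q]. *)
  rewrite -row_free_unit; apply/inj_row_free => x; rewrite mulmxDr mulmx1 => xc.
  have : x *m Q *m (1%:M + P *m Q) = 0.
    by rewrite mulmxDr mulmx1 !mulmxA -mulmxDl -mulmxA xc mul0mx.
  move=> /(congr1 (mulmx^~ (invmx (1%:M + P *m Q)))); rewrite mul0mx mulmxK // => xQ.
  by rewrite -[x]mulmx1 -QQ' mulmxA xQ mul0mx.
have [s cs] := has_type_exists cu; have [sP _] := cs.
suff -> : modify tau = s by [].
apply: modtype_eq_count => //; first exact: is_modtype_modify.
move=> r j rP; rewrite part_modify.
have := nullity_has_typeS j cs rP.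
case: eqP => [rX|/eqP rX]; last first.
  have := nullity_has_typeS j at_ rP.
  have co i : coprimep (r ^+ i) ('X - 1).
    by rewrite coprimep_expl // in_Phi_coprime //; exact: in_Phi_Xsub1.
  rewrite (nullity_core _ _ (co j.+1)) (nullity_core _ _ (co j)).
  by move=> -> /addnI/eqP; rewrite eqn_pmul2l ?in_Phi_size // => /eqP.
have aX n (A : 'M[F]_n) i : peval_mx (1%:M + A) (r ^+ i) = A ^+ i.
  rewrite rX rmorphXn -polyC1 rmorphB /= peval_mxX peval_mxC; congr (_ ^+ _).
  by rewrite addrAC subrr add0r.
have rk i : \rank ((P *m Q) ^+ i.+1) = \rank ((Q *m P) ^+ i).
  have -> : (P *m Q) ^+ i.+1 = P *m (Q *m P) ^+ i *m Q.
    elim: i => [|i IH]; first by rewrite expr1 expr0 mulmx1.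
    by rewrite exprS IH [in RHS]exprS -!mulmxE !mulmxA.
  exact: rank_mulmx_inj P'P QQ'.
have le_km : (k <= m)%N by rewrite -(mxrank1 F k) -P'P mulmx_max_rank.
(* Index [j.+1] for the large matrix matches index [j] for the core; the sizes [m] and [k] cancel in
   the differences. *)
have := nullity_has_typeS j.+1 at_ rP.
rewrite /nullity !aX !rk; have := rank_leq_row ((Q *m P) ^+ j).
have := rank_leq_row ((Q *m P) ^+ j.+1).
have -> : count (fun i => j < i)%N [seq i.-1 | i <- part tau r & (1 < i)%N] =
    count (fun i => j.+1 < i)%N (part tau r).
  rewrite count_map count_filter; apply: eq_count => i /=; lia.
move=> l1 l2 e1 e2; apply/eqP; rewrite -(eqn_pmul2l (in_Phi_size rP)); apply/eqP; lia.
Qed.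

Lemma has_mtypeP m (a : 'M[F]_m) mu : a \in unitmx -> has_mtype a mu <->
  exists k (P : 'M[F]_(m, k)) (Q : 'M[F]_(k, m)) P' Q',
    [/\ P' *m P = 1%:M, Q *m Q' = 1%:M, a = 1%:M + P *m Q & has_type (1%:M + Q *m P) mu].
Proof.
move=> au; split=> [[tau [at_ <-]]|[k [P [Q [P' [Q' [P'P QQ' aE ct]]]]]]].
  have [k [P [Q [P' [Q' [_ PQ P'P QQ']]]]]] := rank_factorization (a - 1%:M).
  have aE : a = 1%:M + P *m Q by rewrite PQ addrC subrK.
  exists k, P, Q, P', Q'; split=> //; rewrite aE in au at_.
  exact: has_type_core P'P QQ' au at_.
have [tau at_] := has_type_exists au; exists tau; split=> //.
rewrite aE in au at_; exact: has_type_uniq (has_type_core P'P QQ' au at_) ct.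
Qed.

Lemma has_type_size n (g : 'M[F]_n) tau : has_type g tau -> n = csize (elem_divs tau).
Proof. by move=> /has_typeP[_ /simmx_size]. Qed.

Lemma has_mtype_exists m (a : 'M[F]_m) : a \in unitmx -> exists mu, has_mtype a mu.
Proof.
by move=> /has_type_exists[tau at_]; exists (modify tau), tau.
Qed.

Lemma has_mtype_uniq m (a : 'M[F]_m) mu nu : has_mtype a mu -> has_mtype a nu -> mu = nu.
Proof. by move=> [s [as_ <-]] [t [at_ <-]]; rewrite (has_type_uniq as_ at_). Qed.

Lemma has_type_simmx m n (g : 'M[F]_m) (g' : 'M[F]_n) tau :
  has_type g tau -> has_type g' tau -> simmx g g'.
Proof.
move=> /has_typeP[_ s] /has_typeP[_ s']; exact: simmx_trans s (simmx_sym s').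
Qed.
End Core.

(** * Counting matrices with prescribed products and kernels *)

Lemma card_fibers (T U : finType) (f : T -> U) (D : {set T}) k :
  (forall x, x \in D -> #|[set z in D | f z == f x]| = k) -> #|D| = (#|f @: D| * k)%N.
Proof.
move=> fk; rewrite -sum1_card (partition_big_imset f) /= -sum_nat_const.
apply: eq_bigr => _ /imsetP[x xD ->]; rewrite -(fk x xD) -sum1_card.
by apply: eq_bigl => z; rewrite inE.
Qed.

Lemma card_over (V T : finType) (g : V -> T) (D : {set V}) (A : {set T}) (k : rat) :
  (forall z, z \in D -> g z \in A) ->
  (forall x, x \in A -> #|[set z in D | g z == x]|%:R = k) ->
  #|D|%:R = #|A|%:R * k.
Proof.
move=> gA fk; rewrite -sum1_card (partition_big g (mem A)) //= natr_sum.
rewrite mulr_natl -sumr_const; apply: eq_bigr => x xA; rewrite -(fk x xA) -sum1_card.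
by congr _%:R; apply: eq_bigl => z; rewrite inE.
Qed.

Section Counting.
Variable F : finFieldType.
Local Notation q := (#|F|%:R : rat).

(** The linear relations among the rows of [R]: a set of vectors of length [r], hence comparable
    between matrices with different numbers of columns. *)
Definition lker r m (R : 'M[F]_(r, m)) : {set 'rV[F]_r} := [set c | c *m R == 0].

Lemma lker_eqP r m m0 (R : 'M[F]_(r, m)) (R0 : 'M[F]_(r, m0)) :
  lker R = lker R0 <-> forall c : 'rV_r, c *m R = 0 <-> c *m R0 = 0.
Proof.
split=> [/setP eqk c|eqk].
  by have := eqk c; rewrite !inE => e; split=> /eqP; [rewrite e|rewrite -e] => /eqP.
by apply/setP => c; rewrite !inE; apply/eqP/eqP => /eqk.
Qed.

(** With equal relations, sending each row of [R] to the corresponding row of [R0] extends to a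
    linear map [V]. *)
Lemma lker_factor r m m0 (R : 'M[F]_(r, m)) (R0 : 'M[F]_(r, m0)) :
  lker R = lker R0 -> exists V, R0 = R *m V.
Proof.
move=> /lker_eqP eqk.
suff /submxP[V VE] : (R0^T <= R^T)%MS by exists V^T; rewrite -[R0]trmxK VE trmx_mul trmxK.
rewrite submxE; move: (cokermx R^T) (mulmx_coker R^T) => K RK.
apply/eqP/trmx_inj; rewrite trmx_mul trmxK trmx0.
apply/row_matrixP => i; rewrite row_mul row0; apply/eqk.
have {}RK : K^T *m R = 0 by rewrite -[LHS]trmxK trmx_mul trmxK RK trmx0.
by rewrite -row_mul RK row0.
Qed.

Lemma lker_rank r m m0 (R : 'M[F]_(r, m)) (R0 : 'M[F]_(r, m0)) :
  lker R = lker R0 -> \rank R = \rank R0.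
Proof.
move=> eqk; apply/eqP; rewrite eqn_leq.
have [V VE] := lker_factor eqk; have [W WE] := lker_factor (esym eqk).
by rewrite {1}WE {3}VE !mxrankM_maxl.
Qed.

Lemma lker_free r m (R : 'M[F]_(r, m)) : row_free R -> lker R = [set 0].
Proof.
move=> /row_freeP[R' RR']; apply/setP => c; rewrite !inE; apply/eqP/eqP => [cR|->].
  by rewrite -[c]mulmx1 -RR' mulmxA cR mul0mx.
by rewrite mul0mx.
Qed.

Lemma card_lker r m (R : 'M[F]_(r, m)) : #|lker R| = (#|F| ^ (r - \rank R))%N.
Proof.
rewrite -mxrank_ker -card_rowg; apply: eq_card => c.
by rewrite !inE; apply/eqP/sub_kermxP.
Qed.

Lemma card_mulmx_fiber r m (R : 'M[F]_(r, m)) (y : 'rV_r) :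
  #|[set c : 'rV_r | c *m R == y *m R]| = #|lker R|.
Proof.
rewrite -(card_imset (lker R) (addrI y)); apply: eq_card => c; rewrite inE.
apply/eqP/imsetP => [cy|[z zR ->]].
  by exists (c - y); [rewrite inE mulmxBl cy subrr|rewrite addrC subrK].
by move: zR; rewrite inE mulmxDl => /eqP->; rewrite addr0.
Qed.

(** If [y0] depends on the rows of [R0], the same combination of the rows of [R] is the only
    solution. Otherwise the solutions form an affine space with [q ^ (m - \rank X0)] points, less
    those in the row space of [R], whose number does not involve [m]. *)
Lemma count_row r e m0 (R0 : 'M[F]_(r, m0)) (X0 : 'M[F]_(m0, e)) (y0 : 'rV[F]_m0) :
  exists p : {poly rat}, forall m (R : 'M[F]_(r, m)) (X : 'M[F]_(m, e)),
    lker R = lker R0 -> lker X^T = lker X0^T -> R *m X = R0 *m X0 ->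
    #|[set y : 'rV_m | (y *m X == y0 *m X0) && (lker (col_mx R y) == lker (col_mx R0 y0))]|%:R
      = p.[q ^+ m].
Proof.
have [/submxP[c y0E]|y0R0] := boolP (y0 <= R0)%MS.
  exists 1 => m R X eqR eqX RX; rewrite hornerC.
  rewrite [S in #|pred_of_set S|](_ : _ = [set c *m R]) ?cards1 //.
  apply/setP => y; rewrite !inE.
  apply/andP/eqP => [[_ /eqP/lker_eqP eqk]|->].
    have /eqk : row_mx c (- 1%:M) *m col_mx R0 y0 = 0.
      by rewrite mul_row_col y0E mulNmx mul1mx subrr.
    by rewrite mul_row_col mulNmx mul1mx => /eqP; rewrite subr_eq0 => /eqP.
  split; first by rewrite -mulmxA RX mulmxA y0E.
  apply/eqP/lker_eqP => u; rewrite -[u]hsubmxK !mul_row_col y0E !mulmxA -!mulmxDl.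
  by have /lker_eqP := eqR.
pose N0 := #|[set c : 'rV_r | c *m (R0 *m X0) == y0 *m X0]|.
(* [N0] counts the [c] for which [c *m R] solves the product equation; each such row arises from
   [#|lker R0|] of them. *)
exists ((q ^- \rank X0) *: 'X - (N0%:R / #|lker R0|%:R)%:P) => m R X eqR eqX RX.
rewrite hornerD hornerN hornerC hornerZ hornerX.
have [V VE] := lker_factor eqX.
have y0X0 : y0 *m X0 = (y0 *m V^T) *m X.
  by rewrite -mulmxA -[X]trmxK -trmx_mul -VE trmxK.
have rkX : \rank X = \rank X0 by rewrite -mxrank_tr (lker_rank eqX) mxrank_tr.
pose A := [set y : 'rV_m | y *m X == y0 *m X0].
pose C := [set c : 'rV_r | c *m (R0 *m X0) == y0 *m X0].
pose B := [set c *m R | c in C].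
have BA : B \subset A.
  by apply/subsetP => y /imsetP[c]; rewrite !inE -RX mulmxA => cC ->.
have -> : [set y : 'rV_m | (y *m X == y0 *m X0) && (lker (col_mx R y) == lker (col_mx R0 y0))]
    = A :\: B.
  apply/setP => y; rewrite !inE; case: (eqVneq (y *m X)) => [yX|_]; rewrite ?andbF ?andbT //=.
  have -> : (y \in B) = (y <= R)%MS.
    apply/imsetP/submxP => [[c _ ->]|[c yE]]; exists c => //.
    by rewrite inE -RX mulmxA -yE yX.
  apply/eqP/negP => [/lker_eqP eqk /submxP[c yE]|yR].
    have /eqk : row_mx c (- 1%:M) *m col_mx R y = 0.
      by rewrite mul_row_col yE mulNmx mul1mx subrr.
    rewrite mul_row_col mulNmx mul1mx => /eqP; rewrite subr_eq0 => /eqP cR0.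
    by case/negP: y0R0; rewrite -cR0 submxMl.
  (* A row outside the row space has coefficient zero in every relation. *)
  have indep k (R1 : 'M[F]_(r, k)) y1 : ~ (y1 <= R1)%MS -> forall u : 'rV_r, forall b : 'rV_1,
      u *m R1 + b *m y1 = 0 <-> b = 0 /\ u *m R1 = 0.
    move=> y1R1 u b; split=> [ub|[-> ->]]; last by rewrite mul0mx addr0.
    have b0 : b = 0.
      rewrite [b]mx11_scalar; case: (eqVneq (b 0 0) 0) => [->|b00]; first by rewrite raddf0.
      case: y1R1; apply/submxP; exists (- (b 0 0)^-1 *: u).
      move: ub; rewrite {1}[b]mx11_scalar mul_scalar_mx => /eqP.
      rewrite addrC addr_eq0 => /eqP ub.
      by rewrite -scalemxAl scaleNr -scalerN -ub scalerA mulVf ?scale1r.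
    by move: ub; rewrite b0 mul0mx addr0.
  apply/lker_eqP => u; rewrite -[u]hsubmxK !mul_row_col !indep //.
    by have /lker_eqP eqk := eqR; split=> -[-> /eqk].
  exact/negP.
rewrite cardsD (setIidPr BA) natrB ?subset_leq_card //; congr (_ - _).
  rewrite /A y0X0 card_mulmx_fiber card_lker rkX natrX.
  have lerk : (\rank X0 <= m)%N by rewrite -rkX rank_leq_row.
  rewrite -{2}(subnK lerk) exprD mulrC mulfK // expf_neq0 // pnatr_eq0 -lt0n.
  by apply/card_gt0P; exists 0.
have eqC : #|C| = (#|B| * #|lker R0|)%N.
  rewrite -eqR; apply: card_fibers => c cC; rewrite -(card_mulmx_fiber R c).
  apply: eq_card => z; rewrite !inE andbC; case: eqP => //= zc.
  by rewrite -RX mulmxA zc -mulmxA RX; rewrite inE in cC.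
rewrite -[N0]/(#|C|) eqC natrM mulfK // pnatr_eq0 -lt0n; apply/card_gt0P.
by exists 0; rewrite inE mul0mx.
Qed.

Lemma lker_col_mxS r m m0 f (R : 'M[F]_(r, m)) (y : 'rV[F]_m) (Y : 'M_(f, m))
    (R0 : 'M[F]_(r, m0)) (y0 : 'rV[F]_m0) (Y0 : 'M_(f, m0)) :
  (lker (col_mx R (col_mx y Y)) == lker (col_mx R0 (col_mx y0 Y0))) =
  (lker (col_mx R y) == lker (col_mx R0 y0)) &&
  (lker (col_mx (col_mx R y) Y) == lker (col_mx (col_mx R0 y0) Y0)).
Proof.
apply/eqP/andP => [/lker_eqP eqk|[_ /eqP/lker_eqP eqk]].
  split; apply/eqP/lker_eqP => c; rewrite -[c]hsubmxK.
    have := eqk (row_mx (lsubmx c) (row_mx (rsubmx c) 0)).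
    by rewrite !mul_row_col !mul0mx !addr0.
  rewrite -[lsubmx c]hsubmxK.
  have := eqk (row_mx (lsubmx (lsubmx c)) (row_mx (rsubmx (lsubmx c)) (rsubmx c))).
  by rewrite !mul_row_col !addrA.
apply/lker_eqP => c; rewrite -[c]hsubmxK -[rsubmx c]hsubmxK.
have := eqk (row_mx (row_mx (lsubmx c) (lsubmx (rsubmx c))) (rsubmx (rsubmx c))).
by rewrite !mul_row_col !addrA.
Qed.

(** The rows of [Y] are chosen one at a time. A chosen row joins [R], and its two conditions become
    the hypotheses on the enlarged [R] for the remaining rows. *)
Lemma count_rows f r e m0 (R0 : 'M[F]_(r, m0)) (X0 : 'M[F]_(m0, e)) (Y0 : 'M[F]_(f, m0)) :
  exists p : {poly rat}, forall m (R : 'M[F]_(r, m)) (X : 'M[F]_(m, e)),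
    lker R = lker R0 -> lker X^T = lker X0^T -> R *m X = R0 *m X0 ->
    #|[set Y : 'M_(f, m) |
        (Y *m X == Y0 *m X0) && (lker (col_mx R Y) == lker (col_mx R0 Y0))]|%:R
      = p.[q ^+ m].
Proof.
elim: f r R0 Y0 => [|f IH] r R0 Y0.
  exists 1 => m R X /lker_eqP eqR eqX RX; rewrite hornerC.
  rewrite [S in #|pred_of_set S|](_ : _ = [set 0]) ?cards1 //.
  apply/setP => Y; rewrite !inE; apply/andP/eqP => [_|_]; first exact: flatmx0.
  split; first by apply/eqP; rewrite (flatmx0 (Y *m X)) (flatmx0 (Y0 *m X0)).
  apply/eqP/lker_eqP => c; rewrite -[c]hsubmxK !mul_row_col.
  by rewrite (flatmx0 Y) (flatmx0 Y0) !mulmx0 !addr0.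
move: Y0; rewrite -[f.+1]/(1 + f)%N => Y0.
pose y0 : 'rV_m0 := usubmx Y0; pose Y1 : 'M_(f, m0) := dsubmx Y0.
have Y0E : Y0 = col_mx y0 Y1 by rewrite /y0 /Y1 vsubmxK.
have [p0 p0E] := count_row R0 X0 y0; have [p1 p1E] := IH _ (col_mx R0 y0) Y1.
exists (p0 * p1) => m R X eqR eqX RX; rewrite hornerM -(p0E m R X) //.
apply: (card_over (g := fun Y : 'M_(1 + f, m) => usubmx Y)) => [Y|y].
  rewrite !inE -[Y]vsubmxK Y0E !mul_col_mx lker_col_mxS.
  by rewrite col_mxKu => /andP[/eqP/eq_col_mx[-> _] /andP[-> _]]; rewrite eqxx.
rewrite inE => /andP[/eqP yX /eqP yR].
rewrite -(p1E m (col_mx R y) X) ?mul_col_mx ?RX ?yX //; congr _%:R.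
have inj : injective (fun Y : 'M[F]_(f, m) => col_mx y Y) by move=> Y Y' /eq_col_mx[].
rewrite -(card_imset _ inj); apply: eq_card => Y; apply/idP/imsetP.
  rewrite !inE -[Y]vsubmxK Y0E !mul_col_mx lker_col_mxS.
  rewrite col_mxKu => /andP[/andP[/eqP/eq_col_mx[_ e1] /andP[_ e2]] /eqP yE].
  by exists (dsubmx Y); rewrite -yE // inE e1 eqxx.
case=> Y' + ->; rewrite [in X in X -> _]inE => /andP[/eqP e1 e2].
by rewrite !inE Y0E !mul_col_mx lker_col_mxS yX e1 yR !eqxx e2 col_mxKu eqxx.
Qed.

End Counting.

(** * Counting tuples over a fixed rank factorisation *)

Section Frames.
Variables (F : finFieldType) (rho s : nat) (L : 'M[F]_rho).
Local Notation q := (#|F|%:R : rat).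

(** A rank factorisation [H1 *m H2] of [h - 1] whose core [1 + L] is prescribed as a matrix, not
    merely up to similarity. *)
Definition frame m (H1 : 'M[F]_(m, rho)) (H2 : 'M[F]_(rho, m)) :=
  [/\ row_free H1^T, row_free H2 & H2 *m H1 = L].

(** For fixed [rho] and [s] the values lie in a finite type that does not involve [m]. *)
Definition config m (H1 : 'M[F]_(m, rho)) (H2 : 'M[F]_(rho, m))
    (XY : 'M[F]_(m, s) * 'M[F]_(s, m)) :=
  (lker (row_mx H1 XY.1)^T, lker (col_mx H2 XY.2),
   col_mx H2 XY.2 *m row_mx H1 XY.1).

(** The columns of [X] are chosen first, as rows of its transpose relative to [H1^T]; then the rows
    of [Y] relative to [H2], with [row_mx H1 X] as the other factor. The frame supplies the initial
    data: no relations, and product [L]. *)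
Lemma count_config m0 (H10 : 'M[F]_(m0, rho)) (H20 : 'M[F]_(rho, m0)) XY0 :
  frame H10 H20 -> exists p : {poly rat}, forall m H1 H2, @frame m H1 H2 ->
    #|[set XY | config H1 H2 XY == config H10 H20 XY0]|%:R = p.[q ^+ m].
Proof.
case: XY0 => X0 Y0 [f10 f20 HL0].
have [p1 p1E] := count_rows H10^T H20^T X0^T.
have [p2 p2E] := count_rows H20 (row_mx H10 X0) Y0.
exists (p1 * p2) => m H1 H2 [f1 f2 HL].
have e1 : lker H1^T = lker H10^T by rewrite !lker_free.
have e2 : lker H2 = lker H20 by rewrite !lker_free.
rewrite hornerM -(p1E m H1^T H2^T) ?trmxK // -?trmx_mul ?HL ?HL0 //.
apply: (card_over (g := fun XY => XY.1^T)) => [[X Y]|x].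
  rewrite !inE /config /= => /eqP[]; rewrite !tr_row_mx => -> _.
  rewrite !mul_col_row => /eq_block_mx[_ eX _ _].
  by rewrite -!trmx_mul eX !eqxx.
rewrite inE -[x]trmxK -!trmx_mul -!tr_row_mx; move: x^T => X.
move=> /andP[/eqP/trmx_inj eX /eqP eK].
rewrite -(p2E m H2 (row_mx H1 X)) //; last by rewrite !mul_mx_row HL HL0 eX.
have inj : injective (fun Y : 'M[F]_(s, m) => (X, Y)) by move=> Y Y' [].
congr _%:R; rewrite -(card_imset _ inj); apply: eq_card => -[X' Y].
rewrite inE; apply/andP/imsetP => [[]|[Y'] + [-> ->]].
  rewrite inE /config /= => /eqP[_ eY eYX] /eqP/trmx_inj eXX'; exists Y; last by rewrite eXX'.
  rewrite inE eY eqxx andbT -eXX'.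
  move: eYX; rewrite !mul_col_mx => /eq_col_mx[_ ->]; exact: eqxx.
rewrite [in X in X -> _]inE => /andP[/eqP eYX /eqP eY]; split; last by rewrite /=.
rewrite inE /config /= eK eY !mul_col_mx eYX; apply/eqP; congr (_, _, col_mx _ _).
by rewrite !mul_mx_row HL HL0 eX.
Qed.

(** An invariant condition holds on whole configuration classes, so the count is a finite sum of the
    polynomials of the classes. *)
Lemma count_cond (cond : forall m, 'M[F]_(m, rho) -> 'M[F]_(rho, m) ->
    'M[F]_(m, s) * 'M[F]_(s, m) -> bool) :
  (forall m H1 H2 XY m' H1' H2' XY', @config m H1 H2 XY = @config m' H1' H2' XY' ->
     cond m H1 H2 XY -> cond m' H1' H2' XY') ->
  exists p : {poly rat}, forall m H1 H2, frame H1 H2 ->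
    #|[set XY | cond m H1 H2 XY]|%:R = p.[q ^+ m].
Proof.
move=> inv; pose I := ({set 'rV[F]_(rho + s)} * {set 'rV[F]_(rho + s)} * 'M[F]_(rho + s))%type.
have /choice[p pE] : forall i : I, exists p : {poly rat}, forall m H1 H2, @frame m H1 H2 ->
    #|[set XY | cond m H1 H2 XY & config H1 H2 XY == i]|%:R = p.[q ^+ m].
  (* A class realised in some size [m0] lends its representative to [count_config]; any other class
     contributes zero in every size. *)
  move=> i; have [[m0 [H10 [H20 [XY0 [fr0 cond0 e0]]]]]|no] := EM (exists m0 H10 H20 XY0,
    [/\ @frame m0 H10 H20, cond m0 H10 H20 XY0 & config H10 H20 XY0 = i]).
    have [p pE] := count_config XY0 fr0; exists p => m H1 H2 fr; rewrite -(pE m H1 H2 fr).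
    congr _%:R; apply: eq_card => XY; rewrite !inE e0 andbC.
    by case: eqP => // e; apply: inv cond0; rewrite e0 e.
  exists 0 => m H1 H2 fr; rewrite horner0; apply/eqP; rewrite pnatr_eq0.
  apply/negPn/negP; rewrite -lt0n => /card_gt0P[XY]; rewrite inE => /andP[c /eqP e].
  by apply: no; exists m, H1, H2, XY.
exists (\sum_i p i) => m H1 H2 fr; rewrite horner_sum.
rewrite -sum1_card (partition_big (config H1 H2) xpredT) //= natr_sum.
apply: eq_bigr => i _; rewrite -(pE i m H1 H2 fr) -sum1_card.
by congr _%:R; apply: eq_bigl => XY; rewrite !inE.
Qed.
End Frames.

(** * Structure constants *)

Section Cores.
Variable F : finFieldType.

Lemma row_freeMr r m n (A : 'M[F]_(r, m)) (V : 'M[F]_(m, n)) : row_free (A *m V) -> row_free A.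
Proof. by move=> /row_freeP[B AVB]; apply/row_freeP; exists (V *m B); rewrite mulmxA. Qed.

Lemma row_free_trP m k (P : 'M[F]_(m, k)) : reflect (exists P', P' *m P = 1%:M) (row_free P^T).
Proof.
apply: (iffP row_freeP) => [[B PB]|[P' P'P]].
  by exists B^T; rewrite -[P]trmxK -trmx_mul PB trmx1.
by exists P'^T; rewrite -trmx_mul P'P trmx1.
Qed.

(** Two rank factorisations differ by a change of basis of the middle space, exhibited as [Q0 *m Q']
    by a right inverse [Q'] of [Q]. *)
Lemma factor_unit m k (P P0 : 'M[F]_(m, k)) (Q Q0 : 'M[F]_(k, m)) :
  row_free P^T -> row_free Q -> row_free P0^T -> row_free Q0 ->
  P *m Q = P0 *m Q0 ->
  exists G, [/\ G \in unitmx, P = P0 *m G & Q = invmx G *m Q0].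
Proof.
move=> /row_free_trP[P' P'P] /row_freeP[Q' QQ'] /row_free_trP[P0' P0'P0] _ PQ.
have PE : P = P0 *m (Q0 *m Q') by rewrite mulmxA -PQ -mulmxA QQ' mulmx1.
have Gu : Q0 *m Q' \in unitmx.
  by have [] // := @mulmx1_unit _ _ (P' *m P0) (Q0 *m Q'); rewrite -mulmxA -PE.
exists (Q0 *m Q'); split=> //; apply: (can_inj (mulKmx Gu)); rewrite mulKVmx //.
by rewrite -[LHS]mul1mx -P0'P0 -mulmxA [P0 *m _]mulmxA -PE PQ mulmxA P0'P0 mul1mx.
Qed.

Lemma has_type_conj m k (P : 'M[F]_(m, k)) (Q : 'M[F]_(k, m)) G mu : G \in unitmx ->
  has_type (1%:M + Q *m P) mu ->
  has_type (1%:M + (invmx G *m Q) *m (P *m G)) mu.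
Proof.
move=> Gu /has_typeP[muP s]; apply/has_typeP; split=> //; apply: simmx_trans s.
exists (invmx G), G; split; rewrite ?mulmxV ?mulVmx //.
by rewrite mulmxDl mulmxDr mul1mx mulmx1 -!mulmxA mulmxV // mulmx1.
Qed.

(** The size [k] is explicit so that [P] and [Q] range over fixed matrix spaces in the count;
    [has_mtype_core] uses the value dictated by [mu]. *)
Definition has_core k m (a : 'M[F]_m) mu := exists (P : 'M[F]_(m, k)) (Q : 'M[F]_(k, m)),
  [/\ row_free P^T, row_free Q, a = 1%:M + P *m Q & has_type (1%:M + Q *m P) mu].

Lemma has_mtype_core m (a : 'M[F]_m) mu : a \in unitmx ->
  has_mtype a mu <-> has_core (csize (elem_divs mu)) a mu.
Proof.
move=> au; split=> [/(has_mtypeP _ au)[k [P [Q [P' [Q' [P'P QQ' aE ct]]]]]]|].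
  have ek := has_type_size ct; subst k; exists P, Q; split=> //.
    by apply/row_free_trP; exists P'.
  by apply/row_freeP; exists Q'.
move=> [P [Q [/row_free_trP[P' P'P] /row_freeP[Q' QQ'] aE ct]]].
by apply/(has_mtypeP _ au); exists (csize (elem_divs mu)), P, Q, P', Q'.
Qed.

Definition GLcard k := #|[set G : 'M[F]_k | G \in unitmx]|.

Lemma GLcard_gt0 k : (0 < GLcard k)%N.
Proof. by apply/card_gt0P; exists 1%:M; rewrite inE unitmx1. Qed.

Section Fixed.
Variables (k l rho : nat) (mu nu : modtype F) (L : 'M[F]_rho).

Definition core_cond m (H1 : 'M[F]_(m, rho)) (H2 : 'M[F]_(rho, m))
    (XY : 'M[F]_(m, k + l) * 'M[F]_(k + l, m)) : bool :=
  let P := lsubmx XY.1 in let R := rsubmx XY.1 in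
  let Q := usubmx XY.2 in let S := dsubmx XY.2 in
  [&& [&& row_free P^T, row_free Q & asbool (has_type (1%:M + Q *m P) mu)],
      [&& row_free R^T, row_free S & asbool (has_type (1%:M + S *m R) nu)]
    & (1%:M + P *m Q) *m (1%:M + R *m S) == 1%:M + H1 *m H2].

(** Equal relations give [V] and [W] with [H1' = V^T H1], [X' = V^T X], [H2' = H2 W] and [Y' = Y W];
    the products inside [Y X] are unchanged. The opposite maps [V'] and [W'] carry over the rank
    conditions. *)
Lemma core_cond_config m H1 H2 XY m' H1' H2' XY' :
  config H1 H2 XY = config H1' H2' XY' ->
  @core_cond m H1 H2 XY -> @core_cond m' H1' H2' XY'.
Proof.
case: XY XY' => [X Y] [X' Y'] [/= eX eY]; rewrite !mul_col_row => /eq_block_mx[_ _ _ eYX].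
have [V VE] := lker_factor eX; have [V' V'E] := lker_factor (esym eX).
have [W WE] := lker_factor eY; have [W' W'E] := lker_factor (esym eY).
move: VE V'E; rewrite !tr_row_mx !mul_col_mx => /eq_col_mx[VH VX] /eq_col_mx[_ V'X].
move: WE W'E; rewrite !mul_col_mx => /eq_col_mx[WH WY] /eq_col_mx[_ W'Y].
have XE : X' = V^T *m X by rewrite -[LHS]trmxK VX trmx_mul trmxK.
have HE : H1' = V^T *m H1 by rewrite -[LHS]trmxK VH trmx_mul trmxK.
have sub_eq : [/\ usubmx Y' *m lsubmx X' = usubmx Y *m lsubmx X,
    usubmx Y' *m rsubmx X' = usubmx Y *m rsubmx X
  & dsubmx Y' *m rsubmx X' = dsubmx Y *m rsubmx X].
  by rewrite !mul_usub_mx !mul_dsub_mx !mulmx_lsub !mulmx_rsub eYX.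
case: sub_eq => e1 e2 e3; rewrite /core_cond /= e1 e3.
move=> /and3P[/and3P[fP fQ ->] /and3P[fR fS ->] /eqP e].
rewrite !andbT; apply/and3P; split.
- apply/andP; split.
    by apply: (@row_freeMr _ _ _ _ V'); rewrite trmx_lsub mul_usub_mx -V'X -trmx_lsub.
  by apply: (@row_freeMr _ _ _ _ W'); rewrite mul_usub_mx -W'Y.
- apply/andP; split.
    by apply: (@row_freeMr _ _ _ _ V'); rewrite trmx_rsub mul_dsub_mx -V'X -trmx_rsub.
  by apply: (@row_freeMr _ _ _ _ W'); rewrite mul_dsub_mx -W'Y.
(* After expansion, [P] or [R] stands at the left end of each term and [Q] or [S] at the right end,
   so the equation is transported by [V^T] and [W]. *)
have expand n n1 n2 (P : 'M[F]_(n, n1)) Q (R : 'M[F]_(n, n2)) S :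
    (1%:M + P *m Q) *m (1%:M + R *m S) =
    1%:M + (P *m Q + R *m S + P *m (Q *m R) *m S).
  by rewrite mulmxDl mul1mx mulmxDr mulmx1 !mulmxA -!addrA; congr (_ + _); rewrite addrCA !addrA.
move: e; rewrite !expand => /addrI e; apply/eqP; congr (_ + _).
rewrite HE WH e2 WY XE -mulmx_lsub -mulmx_rsub -mul_usub_mx -mul_dsub_mx.
have -> : V^T *m H1 *m (H2 *m W) = V^T *m (H1 *m H2) *m W by rewrite !mulmxA.
by rewrite -e !mulmxDr !mulmxDl !mulmxA.
Qed.

(** By [factor_unit] each fibre of [(P, Q, R, S) |-> (1 + P Q, 1 + R S)] is a free orbit of
    [GL_k x GL_l]. *)
Lemma card_core_cond m (H1 : 'M[F]_(m, rho)) (H2 : 'M[F]_(rho, m)) :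
  #|[set XY | core_cond H1 H2 XY]| =
  (#|[set ab : 'M[F]_m * 'M[F]_m | [&& asbool (has_core k ab.1 mu),
      asbool (has_core l ab.2 nu) & ab.1 *m ab.2 == (1%:M + H1 *m H2)%R]]|
   * (GLcard k * GLcard l))%N.
Proof.
pose f (XY : 'M[F]_(m, k + l) * 'M[F]_(k + l, m)) : 'M[F]_m * 'M[F]_m :=
  (1%:M + lsubmx XY.1 *m usubmx XY.2, 1%:M + rsubmx XY.1 *m dsubmx XY.2).
rewrite (card_fibers (f := f) (k := (GLcard k * GLcard l)%N)).
  congr (_ * _)%N; apply: eq_card => -[a b]; apply/imsetP/idP.
    move=> [[X Y]]; rewrite inE => /and3P[/and3P[fP fQ /asboolP cP] /and3P[fR fS /asboolP cR] e] [-> ->].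
    rewrite inE /= e andbT; apply/andP; split; apply/asboolP.
      by exists (lsubmx X), (usubmx Y).
    by exists (rsubmx X), (dsubmx Y).
  rewrite inE /= => /and3P[/asboolP[P [Q [fP fQ -> cP]]] /asboolP[R [S [fR fS -> cR]]] e].
  exists (row_mx P R, col_mx Q S); last by rewrite /f /= row_mxKl row_mxKr col_mxKu col_mxKd.
  rewrite inE /core_cond /= row_mxKl row_mxKr col_mxKu col_mxKd fP fQ fR fS e /=.
  by rewrite !andbT; apply/andP; split; apply/asboolP.
move=> [X Y]; rewrite inE => /and3P[/and3P[fP fQ /asboolP cP] /and3P[fR fS /asboolP cR] e].
rewrite /= in fP fQ cP fR fS cR e.
set P := lsubmx X in fP cP e *; set R := rsubmx X in fR cR e *.
set Q := usubmx Y in fQ cP e *; set S := dsubmx Y in fS cR e *.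
pose phi (G : 'M[F]_k * 'M[F]_l) := (row_mx (P *m G.1) (R *m G.2),
  col_mx (invmx G.1 *m Q) (invmx G.2 *m S)).
pose U := setX [set G : 'M[F]_k | G \in unitmx] [set G : 'M[F]_l | G \in unitmx].
have <- : #|U| = (GLcard k * GLcard l)%N by rewrite cardsX.
have /row_free_trP[P' P'P] := fP; have /row_free_trP[R' R'R] := fR.
have phi_inj : injective phi.
  move=> [G G'] [G1 G1'] [/eq_row_mx[/= e1 e2] _].
  have /(congr1 (mulmx P')) := e1; rewrite !mulmxA P'P !mul1mx => ->.
  by have /(congr1 (mulmx R')) := e2; rewrite !mulmxA R'R !mul1mx => ->.
rewrite -(card_imset _ phi_inj); apply: eq_card => -[X1 Y1]; apply/idP/imsetP.
  rewrite inE [in X in X -> _]inE.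
  move=> /andP[/and3P[/and3P[/= fP1 fQ1 _] /and3P[fR1 fS1 _] _] /eqP[]].
  move=> /addrI e1 /addrI e2.
  have [G [Gu PG QG]] := factor_unit fP1 fQ1 fP fQ e1.
  have [G' [Gu' RG SG]] := factor_unit fR1 fS1 fR fS e2.
  exists (G, G'); first by rewrite !inE Gu Gu'.
  by rewrite /phi /= -PG -QG -RG -SG hsubmxK vsubmxK.
move=> [[G G'] + ->]; rewrite !inE /= => /andP[Gu Gu'].
rewrite /f /core_cond /phi /= row_mxKl row_mxKr col_mxKu col_mxKd.
have e1 : P *m G *m (invmx G *m Q) = P *m Q by rewrite -mulmxA mulKVmx.
have e2 : R *m G' *m (invmx G' *m S) = R *m S by rewrite -mulmxA mulKVmx.
rewrite e1 e2 eqxx e !andbT.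
have free_conj n (A : 'M[F]_(m, n)) (B : 'M_(n, m)) g : g \in unitmx -> row_free A^T -> row_free B ->
    row_free (A *m g)^T && row_free (invmx g *m B).
  move=> gu /row_free_trP[A' A'A] /row_freeP[B' BB']; apply/andP; split.
    apply/row_free_trP; exists (invmx g *m A').
    by rewrite -mulmxA [A' *m _]mulmxA A'A mul1mx mulVmx.
  apply/row_freeP; exists (B' *m g).
  by rewrite -mulmxA [B *m _]mulmxA BB' mul1mx mulVmx.
have /andP[-> ->] := free_conj _ _ _ _ Gu fP fQ.
have /andP[-> ->] := free_conj _ _ _ _ Gu' fR fS.
by apply/andP; split; apply/asboolP; exact: has_type_conj.
Qed.

Definition core_products m (h : 'M[F]_m) : {set 'M[F]_m * 'M[F]_m} :=
  [set ab | [&& asbool (has_core k ab.1 mu), asbool (has_core l ab.2 nu) & ab.1 *m ab.2 == h]].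

(** A core occurring in size [m0] occurs in every larger size. There the polynomial takes a
    cardinality as its value, the integrality that [in_Rq_of_int] requires. *)
Lemma frame_pad m t (H1 : 'M[F]_(m, rho)) (H2 : 'M[F]_(rho, m)) : frame L H1 H2 ->
  frame L (col_mx H1 (0 : 'M_(t, rho))) (row_mx H2 0).
Proof.
move=> [/row_free_trP[P P1] /row_freeP[Q Q1] HL]; split.
- by apply/row_free_trP; exists (row_mx P 0); rewrite mul_row_col mulmx0 addr0.
- by apply/row_freeP; exists (col_mx Q 0); rewrite mul_row_col mulmx0 addr0.
by rewrite mul_row_col mulmx0 addr0.
Qed.

Lemma card_core_products : exists2 r : {poly rat}, in_Rq #|F| r &
  forall m (H1 : 'M[F]_(m, rho)) (H2 : 'M[F]_(rho, m)), frame L H1 H2 ->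
    #|core_products (1%:M + H1 *m H2)|%:R = r.[qint #|F| m].
Proof.
have q_gt1 : (1 < #|F|)%N := card_finNzRing_gt1 F.
have [[m0 [H10 [H20 fr0]]]|no] := EM (exists m0 H10 H20, @frame F rho L m0 H10 H20); last first.
  exists 0; first by apply: in_Rq_values => // m; rewrite horner0; exact: (in_Zqqinv_int q_gt1 0).
  by move=> m H1 H2 fr; case: no; exists m, H1, H2.
have [p pE] := count_cond L core_cond_config.
have c_neq0 : (GLcard k * GLcard l)%:R != 0 :> rat.
  by rewrite pnatr_eq0 -lt0n muln_gt0 !GLcard_gt0.
have p'E m (H1 : 'M[F]_(m, rho)) (H2 : 'M[F]_(rho, m)) : frame L H1 H2 ->
    #|core_products (1%:M + H1 *m H2)|%:R = ((GLcard k * GLcard l)%:R^-1 *: p).[#|F|%:R ^+ m].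
  move=> fr; rewrite hornerZ -(pE m H1 H2 fr) card_core_cond.
  by rewrite [RHS]mulrC (natrM _ #|_|) mulfK.
have [r rR rE] : exists2 r, in_Rq #|F| r &
    forall m, r.[qint #|F| m] = ((GLcard k * GLcard l)%:R^-1 *: p).[#|F|%:R ^+ m].
  apply: (in_Rq_of_int q_gt1 (m0 := m0)) => m le_m.
  rewrite -(subnKC le_m) -(p'E _ _ _ (frame_pad (m - m0) fr0)).
  by eexists; exact: pmulrn.
by exists r => // m H1 H2 fr; rewrite rE p'E.
Qed.

End Fixed.

Lemma gmul_Xcls m (h : 'M[F]_m) mu nu : h \in unitmx ->
  gmul (Xcls mu m) (Xcls nu m) h =
  #|core_products (csize (elem_divs mu)) (csize (elem_divs nu)) mu nu h|%:R.
Proof.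
move=> hu; rewrite /gmul pair_big /= -sum1_card natr_sum [RHS]big_mkcond /=.
apply: eq_bigr => -[a b] _ /=; rewrite inE /=; case: eqP => [abh|_]; last first.
  by rewrite !mul0r !andbF.
have [au bu] : a \in unitmx /\ b \in unitmx by apply/andP; rewrite -unitmx_mul abh.
rewrite mul1r /Xcls au bu /= andbT.
have -> : asbool (has_mtype a mu) = asbool (has_core (csize (elem_divs mu)) a mu).
  exact/asbool_equiv_eq/has_mtype_core.
have -> : asbool (has_mtype b nu) = asbool (has_core (csize (elem_divs nu)) b nu).
  exact/asbool_equiv_eq/has_mtype_core.
by case: (asbool _); case: (asbool _).
Qed.

(** All [h] of modified type [la] have similar cores, so conjugation gives each a rank factorisation
    with one common core [1 + L]. One polynomial then serves them all. *)
Lemma structure_constant (mu nu la : modtype F) : exists2 r : {poly rat}, in_Rq #|F| r &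
  forall m (h : 'M[F]_m), h \in unitmx -> has_mtype h la ->
    (gmul (Xcls mu m) (Xcls nu m) h)%:~R = r.[qint #|F| m].
Proof.
pose rho := csize (elem_divs la).
have [[L LE]|no] := EM (exists L : 'M[F]_rho, has_type (1%:M + L) la); last first.
  exists 0; first by apply: in_Rq_values => [|m]; rewrite ?horner0 ?card_finNzRing_gt1 //;
    apply: (in_Zqqinv_int _ 0); exact: card_finNzRing_gt1.
  move=> m h hu /(has_mtype_core _ hu)[P [Q [_ _ _ ct]]].
  by case: no; exists (Q *m P).
have [r rR rE] := card_core_products (csize (elem_divs mu)) (csize (elem_divs nu)) mu nu L.
exists r => // m h hu hla; rewrite gmul_Xcls //.
have [P [Q [fP fQ hE ct]]] := (has_mtype_core _ hu).1 hla.
have [B [C [BC CB e]]] := has_type_simmx LE ct.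
have LQP : L = B *m (Q *m P) *m C.
  move: e; rewrite mulmxDl mulmxDr mul1mx mulmx1 => /addrI <-.
  by rewrite -mulmxA BC mulmx1.
have -> : h = 1%:M + (P *m C) *m (B *m Q).
  by rewrite hE -mulmxA [C *m _]mulmxA CB mul1mx.
rewrite -(rE m (P *m C) (B *m Q)); last first.
  move: fP fQ => /row_free_trP[P' P'P] /row_freeP[Q' QQ']; split.
  - apply/row_free_trP; exists (B *m P').
    by rewrite -mulmxA [P' *m _]mulmxA P'P mul1mx.
  - apply/row_freeP; exists (Q' *m C).
    by rewrite -mulmxA [Q *m _]mulmxA QQ' mul1mx.
  by rewrite LQP !mulmxA.
by rewrite rmorph_nat.
Qed.

Lemma rank_has_core k m (a : 'M[F]_m) mu : has_core k a mu -> \rank (a - 1%:M) = k.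
Proof.
move=> [P [Q [fP fQ -> _]]]; rewrite addrAC subrr add0r mxrankMfree //.
by rewrite -mxrank_tr; exact/eqP.
Qed.

End Cores.

(** * Finite support and the product formula *)

Section Finiteness.
Variable F : finFieldType.

(** There are finitely many matrices of size at most [n], and each has at most one type. *)
Lemma finite_types n : exists S : seq (modtype F), uniq S /\
  forall rho (L : 'M[F]_rho) la, (rho <= n)%N -> has_type (1%:M + L) la -> la \in S.
Proof.
have /choice[T TE] : forall x : {rho : nat & 'M[F]_rho}, exists la0 : modtype F,
    forall la, has_type (1%:M + tagged x) la -> la0 = la.
  move=> [rho L]; have [[la0 la0E]|no] := EM (exists la, has_type (1%:M + L) la).
    by exists la0 => la laE; exact: has_type_uniq la0E laE.
  (* The empty map is a default for matrices without a type. *)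
  by exists [fmap]%fmap => la laE; case: no; exists la.
exists (undup (flatten [seq [seq T (existT _ rho L) | L <- enum {: 'M[F]_rho}] | rho <- iota 0 n.+1])).
split=> [|rho L la le_rho laE]; first exact: undup_uniq.
rewrite mem_undup; apply/flatten_mapP; exists rho; first by rewrite mem_iota.
apply/mapP; exists L; first by rewrite mem_enum.
by rewrite (TE (existT _ rho L) _ laE).
Qed.

Lemma gmul_Xcls_nonunit m (h : 'M[F]_m) mu nu : h \notin unitmx ->
  gmul (Xcls mu m) (Xcls nu m) h = 0.
Proof.
move=> hu; rewrite /gmul big1 // => a _; rewrite big1 // => b _.
case: eqP => [abh|_]; last by rewrite !mul0r.
move: hu; rewrite -abh unitmx_mul /Xcls.
by case: (a \in unitmx); case: (b \in unitmx); rewrite //= ?mulr0 ?mul0r.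
Qed.

(** From [a b - 1 = (a - 1) b + (b - 1)], the rank of [h - 1] is subadditive; this bounds the core
    sizes that occur in a product. *)
Lemma gmul_Xcls_rank m (h : 'M[F]_m) mu nu : h \in unitmx ->
  gmul (Xcls mu m) (Xcls nu m) h != 0 ->
  (\rank (h - 1%:M)%R <= csize (elem_divs mu) + csize (elem_divs nu))%N.
Proof.
move=> hu; rewrite gmul_Xcls // pnatr_eq0 -lt0n => /card_gt0P[[a b]].
rewrite inE /= => /and3P[/asboolP/rank_has_core <- /asboolP/rank_has_core <- /eqP <-].
have -> : a *m b - 1%:M = (a - 1%:M) *m b + (b - 1%:M).
  by rewrite mulmxBl mul1mx addrA subrK.
by rewrite (leq_trans (mxrank_add _ _)) // leq_add2r mxrankM_maxl.
Qed.
End Finiteness.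

Theorem theorem6p5 (F : finFieldType) (mu nu : modtype F) :
  is_modtype mu -> is_modtype nu ->
  exists (r : modtype F -> {poly rat}) (S : seq (modtype F)),
    [/\ forall la, in_Rq #|F| (r la),
        forall la, r la != 0 -> is_modtype la,
        uniq S,
        forall la, r la != 0 -> la \in S
      & forall (m : nat) (h : 'M[F]_m),
          ((gmul (Xcls mu m) (Xcls nu m)) h)%:~R =
          \sum_(la <- S) (r la).[qint #|F| m] * ((Xcls la m h)%:~R : rat)].
Proof.
move=> _ _; have q_gt1 : (1 < #|F|)%N := card_finNzRing_gt1 F.
have /choice[p pE] : forall la, exists p : {poly rat}, in_Rq #|F| p /\
    forall m (h : 'M[F]_m), h \in unitmx -> has_mtype h la ->
      (gmul (Xcls mu m) (Xcls nu m) h)%:~R = p.[qint #|F| m].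
  by move=> la; have [r] := structure_constant mu nu la; exists r.
have [S [uS SE]] := finite_types F (csize (elem_divs mu) + csize (elem_divs nu)).
(* The polynomial is reset to zero off [S] and off genuine modified types, which forces the support
   conditions. *)
exists (fun la => if (la \in S) && asbool (is_modtype la) then p la else 0), S; split=> //.
- move=> la; case: ifP => _; first exact: (pE la).1.
  by apply: in_Rq_values => // m; rewrite horner0; exact: (in_Zqqinv_int q_gt1 0).
- by move=> la; case: ifP => [/andP[_ /asboolP]|]; rewrite ?eqxx.
- by move=> la; case: ifP => [/andP[]|]; rewrite ?eqxx.
move=> m h; have [hu|hu] := boolP (h \in unitmx); last first.
  rewrite gmul_Xcls_nonunit // big1 // => la _.
  by rewrite /Xcls (negPf hu) mulr0.
have [la hla] := has_mtype_exists hu.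
have la_mod : is_modtype la by case: hla => tau [[tauP _] <-]; exact: is_modtype_modify.
have XE la' : Xcls la' m h = (la' == la)%:R.
  rewrite /Xcls hu /=; congr (_ : bool)%:R; apply/asboolP/eqP => [hla'|-> //].
  exact: has_mtype_uniq hla' hla.
(* Since [h] has exactly one modified type [la], at most one term of the sum survives. *)
have [laS|laS] := boolP (la \in S).
  rewrite (bigD1_seq la) //= laS XE eqxx mulr1 big1 ?addr0 => [|la' /negPf ne].
    by case: asboolP => // _; apply: (pE la).2.
  by rewrite XE ne mulr0.
(* If [la] lies outside [S] the sum is zero; a nonzero product would bound the rank of [h - 1] and
   so put [la] in [S]. *)
rewrite [RHS]big1_seq => [|la' /= la'S]; last first.
  by rewrite XE (negPf (contraNneq _ laS)) ?mulr0 // => <-.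
have [->|nz] := eqVneq (gmul (Xcls mu m) (Xcls nu m) h) 0; first by [].
have hc := (has_mtype_core la hu).1 hla; have := gmul_Xcls_rank hu nz.
rewrite (rank_has_core hc) => le; have [P [Q [_ _ _ ct]]] := hc.
by case/negP: laS; exact: SE le ct.
Qed.
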